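(* $\mathcal{R}(\mathbb{Z}^2)=\mathrm{RE}$, where $\mathbb{Z}^2$ denotes the memory model given by the Cayley graph of $\mathbb{Z}^2$ with generators $(\pm1,0),(0,\pm1)$, and $\mathrm{RE}$ is the class of recursively enumerable languages.
   Context: For a monoid (or group) $\mathcal{M}$ generated by a finite set $G'$, the memory model $(\mathcal{M},G')$ is the Cayley graph: cells are the elements of $\mathcal{M}$, the initial cell is the identity, and for each $x$ and each generator $g$ there is an edge $x\to xg$ marked $g$. An $h$-head automaton with auxiliary memory of model $M$ has a finite state set, input alphabet with endmarkers, a finite memory alphabet $\Delta$, a transition function mapping (state, the $h$ symbols under its 2-way read-only input heads, the current memory symbol) to (new state, a move in $\{-1,0,+1\}$ per head, and a generator to move along or ''stay''), an initial state and accepting states; it starts with heads at the leftmost input symbol and memory at the initial cell and runs deterministically for a fixed memory content $\mu\colon M\to\Delta$. It accepts $w$ iff for some $\mu$ it reaches an accepting state; $\mathcal{R}(M)$ is the class of languages so recognized (any number of heads). *)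

(* Defs.v *)
From HB Require Import structures.
From mathcomp Require Import all_boot all_order all_algebra.

Set Implicit Arguments.
Unset Strict Implicit.
Unset Printing Implicit Defensive.

Import GRing.Theory.

Definition language (Sigma : finType) := seq Sigma -> Prop.

Definition language_class := forall Sigma : finType, language Sigma -> Prop.

Inductive move := MoveL | MoveN | MoveR.

Section Generation.
Local Open Scope group_scope.

Definition generates (M : monoidType) (G : seq M) : Prop :=
  forall x : M, exists2 s : seq M, {subset s <= G} & x = \prod_(y <- s) y.

End Generation.

Record memory_model := MemoryModel {
  mm_cell : monoidType;
  mm_gens : seq mm_cell;
  mm_generates : generates mm_gens }.

Definition mm_init (M : memory_model) : mm_cell M := 1%g.

Definition mm_label (M : memory_model) := seq_sub (mm_gens M).

Definition mm_edge (M : memory_model) (x : mm_cell M) (g : mm_label M) :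
  mm_cell M := (x * val g)%g.

Inductive input_symbol (Sigma : Type) :=
  LeftEnd | Letter of Sigma | RightEnd.
Arguments LeftEnd {Sigma}.
Arguments RightEnd {Sigma}.

Record automaton (Sigma : finType) (M : memory_model) (h : nat) := Automaton {
  au_state : finType;
  au_mem : finType;
  au_trans : au_state -> {ffun 'I_h -> input_symbol Sigma} -> au_mem ->
             au_state * {ffun 'I_h -> move} * option (mm_label M);
  au_start : au_state;
  au_accept : pred au_state }.

(* The extended input occupies positions 0 .. (size w).+1, the letters of w
   being at positions 1 .. size w and the endmarkers at the two extremities. *)
Definition input_at (Sigma : finType) (w : seq Sigma) (p : nat) :
    input_symbol Sigma :=
  if p is i.+1 then
    if onth w i is Some a then Letter a else RightEnd
  else LeftEnd.

(* A head that is told to move past an endmarker stays on it. *)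
Definition move_head (n p : nat) (m : move) : nat :=
  match m with
  | MoveL => p.-1
  | MoveN => p
  | MoveR => minn p.+1 n.+1
  end.

Section Run.
Variables (Sigma : finType) (M : memory_model) (h : nat).
Variable A : automaton Sigma M h.

Record au_config := AuConfig {
  ac_state : au_state A;
  ac_heads : {ffun 'I_h -> nat};
  ac_cell : mm_cell M }.

(* Position 1 is the leftmost letter of w (the right endmarker if w is empty). *)
Definition au_init : au_config :=
  AuConfig (au_start A) [ffun=> 1] (mm_init M).

Definition au_step (mu : mm_cell M -> au_mem A) (w : seq Sigma)
    (c : au_config) : au_config :=
  let: (q, mv, d) :=
    au_trans (ac_state c) [ffun i => input_at w (ac_heads c i)]
             (mu (ac_cell c)) in
  AuConfig q
    [ffun i => move_head (size w) (ac_heads c i) (mv i)]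
    (if d is Some g then mm_edge (ac_cell c) g else ac_cell c).

Definition au_accepts : language Sigma := fun w =>
  exists (mu : mm_cell M -> au_mem A) (t : nat),
    au_accept (ac_state (iter t (au_step mu w) au_init)).

End Run.

Definition R_class (M : memory_model) : language_class := fun Sigma L =>
  exists (h : nat) (A : automaton Sigma M h),
    0 < h /\ forall w, L w <-> au_accepts A w.

(* [Algebra.to_multiplicative] is the library's alias turning the additive group
   [int * int] into a (multiplicatively written) monoid. *)
Definition Z2 : Type := Algebra.to_multiplicative (int * int)%type.
HB.instance Definition _ := Monoid.on Z2.

Definition Z2_gens : seq Z2 :=
  [:: (1, 0); (-1, 0); (0, 1); (0, -1)]%R.

Lemma Z2_generates : generates Z2_gens.
Proof.
have PM x y : (exists2 s : seq Z2, {subset s <= Z2_gens} & x = \prod_(z <- s) z)%g ->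
    (exists2 s : seq Z2, {subset s <= Z2_gens} & y = \prod_(z <- s) z)%g ->
    (exists2 s : seq Z2, {subset s <= Z2_gens} & (x * y) = \prod_(z <- s) z)%g.
  move=> [s hs ->] [t ht ->]; exists (s ++ t); last by rewrite big_cat.
  by move=> z; rewrite mem_cat => /orP[/hs|/ht].
have PX g n : g \in Z2_gens ->
    (exists2 s : seq Z2, {subset s <= Z2_gens} & (g ^+ n) = \prod_(z <- s) z)%g.
  move=> hg; elim: n => [|n IHn]; first by exists [::]; rewrite ?big_nil.
  rewrite expgS; apply: PM IHn; exists [:: g]; last by rewrite big_seq1.
  by move=> z; rewrite inE => /eqP->.
have E (x : int * int) : x = ((x.1, 0) + (0, x.2))%R.
  by case: x => a b; congr (_, _); rewrite /= ?addr0 ?add0r.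
have fstX (x : int * int) n : ((x *+ n).1 = x.1 *+ n)%R by exact: raddfMn.
have sndX (x : int * int) n : ((x *+ n).2 = x.2 *+ n)%R by exact: raddfMn.
have P1 (a : int) : exists g n, g \in Z2_gens /\ ((a, 0) = g *+ n :> (int * int)%type)%R.
  case: a => n; [exists (1, 0)%R, n | exists (-1, 0)%R, n.+1]; split=> //;
  by apply/eqP/andP; rewrite /= fstX sndX /= mul0rn ?mulNrn ?natz ?NegzE.
have P2 (a : int) : exists g n, g \in Z2_gens /\ ((0, a) = g *+ n :> (int * int)%type)%R.
  case: a => n; [exists (0, 1)%R, n | exists (0, -1)%R, n.+1]; split=> //;
  by apply/eqP/andP; rewrite /= fstX sndX /= mul0rn ?mulNrn ?natz ?NegzE.
move=> x; rewrite [x]E; have [g [n [hg ->]]] := P1 x.1.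
by have [k [m [hk ->]]] := P2 x.2; apply: PM; apply: PX.
Qed.

Definition Z2_model : memory_model := MemoryModel Z2_generates.

(* Deterministic Turing machines with [tm_tapes.+1] two-way infinite tapes.
   The tape alphabet is [option (Sigma + tm_work)]: [None] is the blank,
   [Some (inl a)] an input letter, [Some (inr g)] an auxiliary symbol. *)
Definition tape_symbol (Sigma work : finType) : finType :=
  option (Sigma + work)%type.

Record turing_machine (Sigma : finType) := TuringMachine {
  tm_tapes : nat;
  tm_state : finType;
  tm_work : finType;
  tm_trans : tm_state -> {ffun 'I_tm_tapes.+1 -> tape_symbol Sigma tm_work} ->
             tm_state *
             {ffun 'I_tm_tapes.+1 -> tape_symbol Sigma tm_work * move};
  tm_start : tm_state;
  tm_accept : pred tm_state }.

Definition move_val (m : move) : int :=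
  match m with MoveL => -1 | MoveN => 0 | MoveR => 1 end%R.

Section TMRun.
Variables (Sigma : finType) (T : turing_machine Sigma).

Notation symbol := (tape_symbol Sigma (tm_work T)).
Notation index := 'I_(tm_tapes T).+1.

Record tm_config := TMConfig {
  tc_state : tm_state T;
  tc_tapes : {ffun index -> int -> symbol};
  tc_heads : {ffun index -> int} }.

(* The input is written on cells 0 .. (size w).-1 of the first tape; every
   other cell is blank, and all heads start on cell 0. *)
Definition tm_init (w : seq Sigma) : tm_config :=
  TMConfig (tm_start T)
    [ffun i : index => fun z : int =>
       if z is Posz n then
         if i == ord0 then omap inl (onth w n) else None
       else None]
    [ffun=> 0%R].

Definition tm_step (c : tm_config) : tm_config :=
  let: (q, act) :=
    tm_trans (tc_state c) [ffun i => tc_tapes c i (tc_heads c i)] in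
  TMConfig q
    [ffun i => fun z : int =>
       if z == tc_heads c i then (act i).1 else tc_tapes c i z]
    [ffun i => (tc_heads c i + move_val (act i).2)%R].

(* Since [tm_trans] is total, a machine that halts without accepting is
   represented by one that loops forever in a non-accepting state. *)
Definition tm_accepts : language Sigma := fun w =>
  exists t : nat, tm_accept (tc_state (iter t tm_step (tm_init w))).

End TMRun.

Definition RE : language_class := fun Sigma L =>
  exists T : turing_machine Sigma, forall w, L w <-> tm_accepts T w.

(* Main.v *)
Require Import Defs.
From HB Require Import structures.
From mathcomp Require Import all_boot all_order all_algebra zify.

Set Implicit Arguments.
Unset Strict Implicit.
Unset Printing Implicit Defensive.

Import GRing.Theory.

(** From Turing machines to automata: the memory holds a space-time diagram of
    an accepting run, row [t] describing the tapes at time [t] relative to the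
    heads, so that all heads are in column 0; each tape is folded there, which
    leaves only the quadrant [x, t >= 0]. Since a cell of row [t+1] depends on
    three cells of row [t], a diagram restricted to a triangle [x + t <= N]
    suffices, and the automaton checks it row by row, reading row 0 off its
    input head.

    From automata to Turing machines: acceptance depends only on the finite
    sequence of memory symbols read during the run. The machine enumerates all
    such sequences and simulates the automaton on each; a guessed symbol is
    compared with all earlier reads in the same cell by following the recorded
    moves backwards with two counters that hold the displacement.

    Both devices are programmed in a small while-language whose programs compile
    to finite controls. *)

(** * A while-language compiled to finite controls *)

Section Syntax.
Variables (V O A : Type).

Inductive cmd :=
  | Act of (V -> O -> V * A)
  | Seq of cmd & cmd
  | While of (V -> O -> bool) & cmd.

(** In a loop, [None] is the test and [Some p] a point of the body. Termination is not a program
    point: [control] signals it by giving no successor. *)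
Fixpoint pcs (c : cmd) : finType :=
  match c with
  | Act _ => unit
  | Seq c1 c2 => (pcs c1 + pcs c2)%type
  | While _ c1 => option (pcs c1)
  end.

Fixpoint entry (c : cmd) : pcs c :=
  match c return pcs c with
  | Act _ => tt
  | Seq c1 _ => inl (entry c1)
  | While _ _ => None
  end.

Variable skip : A.

(** At the end of a loop body [k] is [None], so that [Some k] returns to the loop test. The test
    takes a step of its own, with action [skip]. *)
Fixpoint control (c : cmd) : pcs c -> V -> O -> option (pcs c) * (V * A) :=
  match c return pcs c -> V -> O -> option (pcs c) * (V * A) with
  | Act f => fun _ v o => (None, f v o)
  | Seq c1 c2 => fun p v o =>
      match p with
      | inl p1 => let: (k, r) := control p1 v o in
          (Some (if k is Some p1' then inl p1' else inr (entry c2)), r)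
      | inr p2 => let: (k, r) := control p2 v o in
          (if k is Some p2' then Some (inr p2') else None, r)
      end
  | While b c1 => fun p v o =>
      match p with
      | Some p1 => let: (k, r) := control p1 v o in (Some k, r)
      | None => (if b v o then Some (Some (entry c1)) else None, (v, skip))
      end
  end.

(** A halted program stays as it is, because both machine models keep stepping forever. *)
Definition halting_control (c : cmd) (q : option (pcs c) * V) (o : O) :
    (option (pcs c) * V) * A :=
  if q.1 is Some p then
    let: (k, (v, a)) := control p q.2 o in ((k, v), a)
  else (q, skip).

End Syntax.

(** * Big-step semantics and correctness of compilation *)

Section Semantics.
Variables (V O A : Type) (skip : A) (S : Type).
Variables (obs : S -> O) (perf : A -> S -> S).
Hypothesis perf_skip : forall s, perf skip s = s.

Notation cmd := (cmd V O A).

Inductive eval : cmd -> V * S -> V * S -> Prop :=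
  | EvalAct f v s : eval (Act f) (v, s) ((f v (obs s)).1, perf (f v (obs s)).2 s)
  | EvalSeq c1 c2 s s1 s2 : eval c1 s s1 -> eval c2 s1 s2 -> eval (Seq c1 c2) s s2
  | EvalWhileF b c v s : ~~ b v (obs s) -> eval (While b c) (v, s) (v, s)
  | EvalWhileT (b : V -> O -> bool) c v s s1 s2 : b v (obs s) -> eval c (v, s) s1 ->
      eval (While b c) s1 s2 -> eval (While b c) (v, s) s2.

Definition mstep (c : cmd) (x : option (pcs c) * (V * S)) :
    option (pcs c) * (V * S) :=
  let: (q, a) := halting_control skip (x.1, x.2.1) (obs x.2.2) in
  (q.1, (q.2, perf a x.2.2)).

Lemma mstep_None c vs : mstep (None : option (pcs c), vs) = (None, vs).
Proof. by case: vs => v s; rewrite /mstep /= perf_skip. Qed.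

Lemma iter_mstep_None c vs t :
  iter t (@mstep c) (None, vs) = (None, vs).
Proof. by elim: t => //= t ->; rewrite mstep_None. Qed.

Definition halts c (p : option (pcs c)) vs vs' :=
  exists t, iter t (@mstep c) (p, vs) = (None, vs').

Lemma halts_None c vs vs' : halts (None : option (pcs c)) vs vs' <-> vs = vs'.
Proof.
split=> [[t]|->]; last by exists 0.
by rewrite iter_mstep_None => -[].
Qed.

Lemma halts_step c p vs vs' :
  let: (p1, vs1) := @mstep c (Some p, vs) in
  halts (Some p) vs vs' <-> halts p1 vs1 vs'.
Proof.
case E: mstep => [p1 vs1]; split=> [[[|t]]|[t H]] //; last first.
  by exists t.+1; rewrite iterSr E.
by rewrite iterSr E; exists t.
Qed.

Lemma halts_Seq2 c1 c2 p vs vs' :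
  @halts (Seq c1 c2) (omap inr p) vs vs' <-> @halts c2 p vs vs'.
Proof.
have E t q ws : iter t (@mstep (Seq c1 c2)) (omap inr q, ws) =
    let: (q1, ws1) := iter t (@mstep c2) (q, ws) in (omap inr q1, ws1).
  elim: t q ws => [|t IH] q ws //; rewrite !iterSr.
  case: q => [q|]; last by rewrite !mstep_None -IH.
  case: ws => v s; rewrite /mstep /= /halting_control /=.
  by case: (control _ _ _ _) => -[q1|] [v1 a] /=; rewrite -IH.
split=> -[t H]; exists t; move: H; rewrite E; case: (iter _ _ _) => -[q|] ws //=;
by case=> ->.
Qed.

Lemma halts_Seq1 c1 c2 p vs vs' :
  @halts (Seq c1 c2) (Some (inl p)) vs vs' <->
  exists2 vs1, @halts c1 (Some p) vs vs1 & @halts c2 (Some (entry c2)) vs1 vs'.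
Proof.
split.
  move=> [t]; elim: t p vs => // t IH p [v s]; rewrite iterSr.
  have := halts_step p (v, s); rewrite /mstep /= /halting_control /=.
  case: (control _ _ _ _) => -[q1|] [v1 a] /= E.
    by move=> /IH [ws H1 H2]; exists ws => //; apply/E.
  move=> H; exists (v1, perf a s); first by apply/E/halts_None.
  by apply/(@halts_Seq2 c1); exists t.
move=> [vs1 [t]]; elim: t p vs => // t IH p [v s]; rewrite iterSr.
have := @halts_step (Seq c1 c2) (inl p) (v, s) vs'.
rewrite /mstep /= /halting_control /=.
case: (control _ _ _ _) => -[q1|] [v1 a] /= E.
  by move=> /IH H /H ?; apply/E.
by rewrite iter_mstep_None => -[<-] H; apply/E/(@halts_Seq2 c1 c2 (Some _)).
Qed.

(** Splits a run at its first return to the loop test; the strict bound feeds the strong induction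
    on running time in [halts_eval]. *)
Lemma halts_While1 b c p t v s vs' :
  iter t (@mstep (While b c)) (Some (Some p), (v, s)) = (None, vs') ->
  exists t1 vs1, [/\ t1 < t, halts (Some p) (v, s) vs1 &
    iter t1 (@mstep (While b c)) (Some None, vs1) = (None, vs')].
Proof.
elim: t p v s => // t IH p v s; rewrite iterSr.
have := halts_step p (v, s); rewrite /mstep /= /halting_control /=.
case: (control _ _ _ _) => -[q1|] [v1 a] /= E.
  move=> /IH [t1 [ws [lt H1 H2]]]; exists t1, ws; split=> //; first exact: ltnW.
  exact/E.
move=> H; exists t, (v1, perf a s); split=> //.
exact/E/halts_None.
Qed.

Lemma halts_While2 b c p vs vs1 vs' :
  @halts c (Some p) vs vs1 -> @halts (While b c) (Some None) vs1 vs' ->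
  @halts (While b c) (Some (Some p)) vs vs'.
Proof.
move=> [t]; elim: t p vs => // t IH p [v s]; rewrite iterSr.
have := @halts_step (While b c) (Some p) (v, s) vs'.
rewrite /mstep /= /halting_control /=.
case: (control _ _ _ _) => -[q1|] [v1 a] /= E.
  by move=> /IH H /H ?; apply/E.
by rewrite iter_mstep_None => -[<-] H; apply/E.
Qed.

(** From left to right by induction on the command, with strong induction on time for loops; from
    right to left by induction on the derivation. *)
Lemma halts_eval c vs vs' : halts (Some (entry c)) vs vs' <-> eval c vs vs'.
Proof.
split.
  elim: c vs vs' => [f|c1 IH1 c2 IH2|b c IH] vs vs'.
  - have := halts_step (tt : pcs (Act f)) vs vs'; case: vs => v s.
    rewrite /mstep /= /halting_control /=.
    case E: (f _ _) => [v1 a] /= [H _] /H /halts_None <-.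
    by have := EvalAct f v s; rewrite E.
  - by move=> /halts_Seq1 [vs1 /IH1 H1 /IH2]; exact: EvalSeq.
  move=> [t]; elim/ltn_ind: t vs => -[//|t] IHt [v s]; rewrite iterSr.
  have -> : @mstep (While b c) (Some None, (v, s)) =
      (if b v (obs s) then Some (Some (entry c)) else None, (v, s)).
    by rewrite /mstep /= /halting_control /= perf_skip.
  case: ifP => Hb; last first.
    by rewrite iter_mstep_None => -[<-]; apply: EvalWhileF; rewrite Hb.
  move=> /halts_While1 [t1 [vs1 [lt /IH H1 H2]]].
  by apply: EvalWhileT Hb H1 (IHt _ _ _ H2); apply: ltnW.
elim=> {c vs vs'}.
- move=> f v s; have := @halts_step (Act f) tt (v, s).
  rewrite /mstep /= /halting_control /=.
  by case: (f _ _) => v1 a /= H; apply/H/halts_None.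
- by move=> c1 c2 s s1 s2 _ H1 _ H2; apply/halts_Seq1; exists s1.
- move=> b c v s Hb; have := @halts_step (While b c) None (v, s).
  rewrite /mstep /= /halting_control /= perf_skip (negPf Hb) => H.
  exact/H/halts_None.
move=> b c v s s1 s2 Hb _ H1 _ H2; have := @halts_step (While b c) None (v, s).
rewrite /mstep /= /halting_control /= perf_skip Hb => H.
exact/H/(halts_While2 H1).
Qed.

(** A halted run is stationary, so the longer of the two runs exhibits both results. *)
Lemma eval_det c s s1 s2 : eval c s s1 -> eval c s s2 -> s1 = s2.
Proof.
move=> /halts_eval [t1 H1] /halts_eval [t2 H2].
wlog le : t1 t2 s1 s2 H1 H2 / t1 <= t2.
  by move=> W; case/orP: (leq_total t1 t2) => le; [|symmetry]; exact: (W _ _ _ _ _ _ le).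
by move: H2; rewrite -(subnK le) iterD H1 iter_mstep_None => -[].
Qed.

Definition run_act (f : V -> O -> V * A) v s : V * S :=
  ((f v (obs s)).1, perf (f v (obs s)).2 s).
Arguments run_act f v s /.

Lemma eval_actP f v s s' : eval (Act f) (v, s) s' -> s' = run_act f v s.
Proof. by move=> E; inversion E. Qed.

Lemma eval_seqP c1 c2 s s' : eval (Seq c1 c2) s s' ->
  exists2 s1, eval c1 s s1 & eval c2 s1 s'.
Proof. by move=> E; inversion E; subst; exists s1. Qed.

(** Hoare's rule for loops, in the sense of partial correctness. *)
Lemma eval_whileP (I : V * S -> Prop) (b : V -> O -> bool) c :
  (forall v s s', I (v, s) -> b v (obs s) -> eval c (v, s) s' -> I s') ->
  forall s s', I s -> eval (While b c) s s' -> I s' /\ ~~ b s'.1 (obs s'.2).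
Proof.
move=> H s s' Is E; move: Is.
move eqw : (While b c) E => w E.
elim: E eqw => // {w s s'}.
  by move=> b1 c1 v s nb [e1 _] Is; subst.
move=> b1 c1 v s s1 s2 Hb E1 _ _ IH [e1 e2] Is; subst; apply: IH => //.
exact: H Is Hb E1.
Qed.

(** A failed test diverges, so the existence of an evaluation certifies the test. *)
Definition assert (b : V -> O -> bool) : cmd :=
  While (fun v o => ~~ b v o) (Act (fun v _ => (v, skip))).

Lemma eval_assertP (b : V -> O -> bool) v s s' :
  eval (assert b) (v, s) s' -> b v (obs s) /\ s' = (v, s).
Proof.
move=> /(eval_whileP (I := fun x => x = (v, s))) [] //.
  by move=> v1 s1 s2 -[-> ->] _ /eval_actP /= ->; rewrite perf_skip.
by move=> ->; rewrite negbK.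
Qed.

Lemma eval_assert (b : V -> O -> bool) v s :
  b v (obs s) -> eval (assert b) (v, s) (v, s).
Proof. by move=> H; apply: EvalWhileF; rewrite negbK. Qed.

Lemma eval_act f v s v' s' : (f v (obs s)).1 = v' ->
  perf (f v (obs s)).2 s = s' -> eval (Act f) (v, s) (v', s').
Proof. by move=> <- <-; exact: EvalAct. Qed.

Lemma eval_act_seq f c v s s2 :
  eval c (run_act f v s) s2 -> eval (Seq (Act f) c) (v, s) s2.
Proof. by apply: EvalSeq; exact: EvalAct. Qed.

Lemma eval_assert_seq (b : V -> O -> bool) c v s s2 :
  b v (obs s) -> eval c (v, s) s2 -> eval (Seq (assert b) c) (v, s) s2.
Proof. by move=> H; apply: EvalSeq; exact: eval_assert. Qed.

End Semantics.
Arguments eval_act_seq {V O A S obs perf f c v s s2}.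
Arguments eval_assert_seq {V O A skip S obs perf b c v s s2}.
Arguments run_act {V O A S} obs perf f v s /.
Arguments eval_actP {V O A S obs perf f v s s'}.
Arguments eval_seqP {V O A S obs perf c1 c2 s s'}.
Arguments eval_assertP {V O A skip S obs perf} perf_skip {b v s s'}.
Arguments eval_whileP {V O A S obs perf I b c}.
Arguments eval_assert {V O A skip S obs perf b v s}.
Arguments eval_act {V O A S obs perf f v s v' s'}.

(** * Offsets of tape cells from a moving head *)

Section IntegerShifts.
Local Open Scope ring_scope.
Variables (p : int) (x : nat).

Lemma addz_posS_neq : (p + x.+1%:Z == p) = false.
Proof. lia. Qed.

Lemma subz_posS_neq : (p - x.+1%:Z == p) = false.
Proof. lia. Qed.

Lemma subz1_sub : p + -1 - x.+1%:Z = p - x.+2%:Z.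
Proof. lia. Qed.

Lemma subz1_add : p + -1 + x.+1%:Z = p + x%:Z.
Proof. lia. Qed.

Lemma addz1_add : p + 1 + x%:Z = p + x.+1%:Z.
Proof. lia. Qed.

Lemma addz1_sub : p + 1 - x.+2%:Z = p - x.+1%:Z.
Proof. lia. Qed.

End IntegerShifts.

(** * From Turing machines to automata *)

Section AutomatonProgram.
Variables (Sigma : finType) (M : memory_model) (h : nat) (V D : finType).

Definition au_obs_type := ({ffun 'I_h -> input_symbol Sigma} * D)%type.
Definition au_action := ({ffun 'I_h -> move} * option (mm_label M))%type.
Definition au_store := ({ffun 'I_h -> nat} * mm_cell M)%type.

Definition au_skip : au_action := ([ffun=> MoveN], None).

Definition au_obs (mu : mm_cell M -> D) (w : seq Sigma) (s : au_store) :
    au_obs_type := ([ffun i => input_at w (s.1 i)], mu s.2).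

Definition au_perf (w : seq Sigma) (a : au_action) (s : au_store) : au_store :=
  ([ffun i => move_head (size w) (s.1 i) (a.1 i)],
   if a.2 is Some g then mm_edge s.2 g else s.2).

Lemma au_perf_skip w s : au_perf w au_skip s = s.
Proof. by case: s => f p; congr (_, _); apply/ffunP=> i; rewrite !ffunE. Qed.

Variables (c : cmd V au_obs_type au_action) (v0 : V).

(** Acceptance is termination: the accepting states are those without a program point. *)
Definition program_automaton : automaton Sigma M h :=
  @Automaton Sigma M h (option (pcs c) * V)%type D
    (fun q f d => let: (q1, a) := halting_control au_skip q (f, d) in
       (q1, a.1, a.2))
    (Some (entry c), v0) (fun q => ~~ q.1).

Lemma program_automaton_accepts w :
  au_accepts program_automaton w <->
  exists mu s', eval (au_obs mu w) (au_perf w) c (v0, ([ffun=> 1], mm_init M)) s'.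
Proof.
pose f (x : option (pcs c) * (V * au_store)) : au_config program_automaton :=
  @AuConfig Sigma M h program_automaton (x.1, x.2.1) x.2.2.1 x.2.2.2.
have stepE mu x : @au_step _ _ _ program_automaton mu w (f x) =
    f (mstep au_skip (au_obs mu w) (au_perf w) x).
  case: x => p [v s]; rewrite /au_step /mstep /au_obs /=.
  by case: (halting_control _ _ _) => -[q u] a.
have iterE mu t x : iter t (@au_step _ _ _ program_automaton mu w) (f x) =
    f (iter t (mstep au_skip (au_obs mu w) (au_perf w) (c:=c)) x).
  by elim: t => //= t ->.
pose x0 := (Some (entry c), (v0, (([ffun=> 1], mm_init M) : au_store))).
have initE : au_init program_automaton = f x0 by [].
split=> [[mu [t]]|[mu [s' /(halts_eval (au_obs mu w) (@au_perf_skip w))[t Ht]]]]; last first.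
  by exists mu, t; rewrite initE iterE Ht.
rewrite initE iterE /=; case E: (iter _ _ _) => [[p|] s'] //= _.
by exists mu, s'; apply/(halts_eval (au_obs mu w) (@au_perf_skip w)); exists t.
Qed.

End AutomatonProgram.

(** * Moves inside a quadrant of the grid *)

Section GridMoves.

Definition right_gen : mm_label Z2_model := @SeqSub Z2 Z2_gens (1, 0)%R isT.
Definition left_gen : mm_label Z2_model := @SeqSub Z2 Z2_gens (-1, 0)%R isT.
Definition up_gen : mm_label Z2_model := @SeqSub Z2 Z2_gens (0, 1)%R isT.
Definition down_gen : mm_label Z2_model := @SeqSub Z2 Z2_gens (0, -1)%R isT.

Definition grid (x y : nat) : mm_cell Z2_model := (x%:Z, y%:Z)%R.

Lemma mulZ2E (p q : mm_cell Z2_model) : (p * q)%g = (p.1 + q.1, p.2 + q.2)%R :> Z2.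
Proof. by []. Qed.

Lemma edge_right x y : mm_edge (grid x y) right_gen = grid x.+1 y.
Proof. by rewrite /mm_edge mulZ2E /= addr0 addrC -intS. Qed.

Lemma edge_up x y : mm_edge (grid x y) up_gen = grid x y.+1.
Proof. by rewrite /mm_edge mulZ2E /= addr0 addrC -intS. Qed.

Lemma edge_left x y : mm_edge (grid x.+1 y) left_gen = grid x y.
Proof. by rewrite /mm_edge mulZ2E /= addr0 intS addrAC subrr add0r. Qed.

Lemma edge_down x y : mm_edge (grid x y.+1) down_gen = grid x y.
Proof. by rewrite /mm_edge mulZ2E /= addr0 intS addrAC subrr add0r. Qed.

End GridMoves.

(** * Space-time diagrams and the program that checks them *)

Section TuringToAutomaton.
Variables (Sigma : finType) (T : turing_machine Sigma).

Notation I := 'I_(tm_tapes T).+1.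
Notation sym := (tape_symbol Sigma (tm_work T)).

Definition tapes_view : Type := {ffun I -> sym * sym}.
HB.instance Definition _ := Finite.on tapes_view.

Definition view (c : tm_config T) (x : nat) : tapes_view :=
  [ffun i => (tc_tapes c i (tc_heads c i + x%:Z)%R,
              tc_tapes c i (tc_heads c i - x.+1%:Z)%R)].

(* [axis] marks column 0 and [border] the last column of the row to be checked;
   the view at [x] consists of the cells at offsets [x] and [-x-1] of the heads. *)
Definition diagram_cell : Type := (bool * bool * tapes_view)%type.
HB.instance Definition _ := Finite.on diagram_cell.

Definition axis (d : diagram_cell) : bool := d.1.1.
Definition border (d : diagram_cell) : bool := d.1.2.
Definition content (d : diagram_cell) : tapes_view := d.2.

(** Here [a], [b], [c] are the cells in columns [x-1], [x], [x+1] of the old row, and [z] is the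
    symbol written at the old offset 0. A left move turns the old offset [y] into [y+1], a right
    move into [y-1]; the fold makes column 0 special. *)
Definition next_content (q : tm_state T) (r : {ffun I -> sym})
    (a b c : diagram_cell) : tapes_view :=
  [ffun i => let: (z, m) := (tm_trans q r).2 i in
   match m with
   | MoveL => (if axis b then (content b i).2 else
               if axis a then z else (content a i).1, (content c i).2)
   | MoveN => (if axis b then z else (content b i).1, (content b i).2)
   | MoveR => ((content c i).1, if axis b then z else (content a i).2)
   end].

Definition correct (c : tm_config T) (x : nat) (d : diagram_cell) :=
  axis d = (x == 0) /\ content d = view c x.

(** Column 0 has no left neighbour, so [a] is constrained only for [0 < x]; [next_content] tests
    [axis b] before it consults [a]. *)
Lemma next_contentE (c : tm_config T) r x (a b d : diagram_cell) :
  r = [ffun i => (view c 0 i).1] ->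
  (0 < x -> correct c x.-1 a) -> correct c x b -> correct c x.+1 d ->
  next_content (tc_state c) r a b d = view (tm_step c) x.
Proof.
move=> -> Ha [Hb1 Hb2] [Hd1 Hd2]; apply/ffunP => i; rewrite /tm_step.
have -> : [ffun i => (view c 0 i).1] =
    [ffun i => tc_tapes c i (tc_heads c i)] :> {ffun I -> sym}.
  by apply/ffunP=> j; rewrite !ffunE addr0.
rewrite !ffunE; case: (tm_trans _ _) => q act /=; rewrite !ffunE.
case: (act i) => z m /=; rewrite Hb1 Hb2 Hd2 !ffunE /=.
have [offS offN] := (addz_posS_neq (tc_heads c i), subz_posS_neq (tc_heads c i)).
case: m => /=; set p := tc_heads c i.
- rewrite subz1_sub offN.
  case: x Ha {Hb1 Hb2 Hd1 Hd2} => [|x] Ha /=; first by rewrite addr0 (offN 0).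
  have [-> ->] := Ha isT; rewrite !ffunE /= subz1_add.
  by case: x {Ha} => [|x] /=; rewrite ?addr0 ?eqxx // offS.
- rewrite addr0 offN.
  by case: x {Ha Hb1 Hb2 Hd1 Hd2} => [|x] /=; rewrite ?addr0 ?eqxx // offS.
rewrite addz1_add offS.
case: x Ha {Hb1 Hb2 Hd1 Hd2} => [|x] Ha /=; first by rewrite addrK eqxx.
by have [_ ->] := Ha isT; rewrite ffunE /= addz1_sub offN.
Qed.

Definition row0_content (a : input_symbol Sigma) : tapes_view :=
  [ffun i => (if i == ord0 then
                if a is Letter x then Some (inl x) else None
              else None, None)].

(** Column [x] matches input position [x.+1] because position 0 is the left endmarker; the right
    endmarker stands for a blank. *)
Lemma view_init w x : view (tm_init T w) x = row0_content (input_at w x.+1).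
Proof.
apply/ffunP=> i; rewrite !ffunE add0r; congr (_, _).
by rewrite /=; case: (onth w x).
Qed.

(** The machine state, the symbols scanned in the current row, and the cells called [a], [b], [e] in
    [check_cell]. *)
Definition checker_vars : Type :=
  (tm_state T * {ffun I -> sym} * diagram_cell * diagram_cell * diagram_cell)%type.
HB.instance Definition _ := Finite.on checker_vars.

Notation obs_type := (au_obs_type Sigma 1 diagram_cell).
Notation action := (au_action Z2_model 1).
Notation cmd := (cmd checker_vars obs_type action).
Notation skip := (au_skip Z2_model 1).

Definition walk (g : mm_label Z2_model) : action := ([ffun=> MoveN], Some g).

Definition go (g : mm_label Z2_model) : cmd := Act (fun v _ => (v, walk g)).

Definition back_to_axis : cmd :=
  While (fun _ o => ~~ axis o.2) (go left_gen).

Definition row0_ok (o : obs_type) : bool := content o.2 == row0_content (o.1 ord0).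

Definition check_row0 : cmd :=
  Seq (assert skip (fun _ o => axis o.2 && row0_ok o))
  (Seq (While (fun _ o => ~~ border o.2)
         (Seq (Act (fun v _ => (v, ([ffun=> MoveR], Some right_gen))))
              (assert skip (fun _ o => ~~ axis o.2 && row0_ok o))))
       back_to_axis).

(* Starts at (x, t) with [b], [a] and [e] the cells (x, t), (x-1, t) and
   (x, t+1), and ends at (x+1, t) with the same invariant. *)
Definition check_cell : cmd :=
  Seq (go right_gen)
  (Seq (assert skip (fun v o => let: (q, r, a, b, e) := v in
          (axis e == axis b) && (content e == next_content q r a b o.2)))
  (Seq (Act (fun v o => let: (q, r, a, b, e) := v in
          ((q, r, b, o.2, e), walk up_gen)))
       (Act (fun v o => let: (q, r, a, b, e) := v in
          ((q, r, a, b, o.2), walk down_gen))))).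

(* The border moves one step left from each row to the next, because the cell
   of row t+1 above the border of row t is not determined by the checked part. *)
Definition check_next_row : cmd :=
  Seq (assert skip (fun _ o => ~~ border o.2))
  (Seq (Act (fun v o => let: (q, r, a, b, e) := v in
          ((q, [ffun i => (content o.2 i).1], a, o.2, e), walk up_gen)))
  (Seq (Act (fun v o => let: (q, r, a, b, e) := v in
          ((q, r, a, b, o.2), walk down_gen)))
  (Seq (While (fun _ o => ~~ border o.2) check_cell)
  (Seq (go up_gen)
  (Seq (go left_gen)
  (Seq (assert skip (fun _ o => border o.2))
  (Seq back_to_axis
       (Act (fun v o => let: (q, r, a, b, e) := v in
          (((tm_trans q r).1, r, a, b, e), skip)))))))))).

Definition check_diagram : cmd :=
  Seq check_row0
      (While (fun v _ => ~~ tm_accept (v.1.1.1.1)) check_next_row).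

(** * Soundness of the checker *)

Section Checking.
Variables (w : seq Sigma) (mu : mm_cell Z2_model -> diagram_cell).

Notation eval := (eval (au_obs mu w) (au_perf w)).
Notation cell x t := (mu (grid x t)).
Notation config t := (iter t (@tm_step _ T) (tm_init T w)).

Definition row_correct t B :=
  border (cell B t) /\ forall x, x <= B -> correct (config t) x (cell x t).

Lemma au_perf_walk g f p : au_perf w (walk g) (f, p) = (f, mm_edge p g).
Proof. by congr (_, _); apply/ffunP => i; rewrite !ffunE. Qed.

(** Up to the border of a correct row the axis mark occurs in column 0 and nowhere else, so the walk
    stops exactly there. *)
Lemma back_to_axis_sound t B v f x s' : row_correct t B -> x <= B ->
  eval back_to_axis (v, (f, grid x t)) s' -> s' = (v, (f, grid 0 t)).
Proof.
move=> [_ HB] xB.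
pose Inv (s : checker_vars * au_store Z2_model 1) :=
  exists2 y, y <= B & s = (v, (f, grid y t)).
move=> /(eval_whileP (I := Inv)) [].
- move=> u1 p1 s1 [y yB [-> ->]] /= nax /eval_actP -> /=.
  case: y yB nax => [|y] yB; first by have [-> _] := HB _ yB.
  by move=> _; exists y; [exact: ltnW | rewrite au_perf_walk edge_left].
- by exists x.
by move=> [y yB ->] /=; have [-> _] := HB _ yB; rewrite negbK => /eqP ->.
Qed.

(** The head rests on the right endmarker while the walk along row 0 goes on, and keeps supplying
    the symbol of all further positions. *)
Lemma input_at_clamp x : input_at w (minn x.+1 (size w).+1) = input_at w x.+1.
Proof.
rewrite minnSS; case: (leqP x (size w)) => // lt /=.
by rewrite !onth_default // ltnW.
Qed.

Lemma row0_okE x : row0_ok (au_obs mu w ([ffun=> minn x.+1 (size w).+1], grid x 0)) =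
  (content (cell x 0) == view (config 0) x).
Proof. by rewrite /row0_ok view_init /= ffunE ffunE input_at_clamp. Qed.

Lemma move_right_perf x : au_perf w ([ffun=> MoveR], Some right_gen)
    ([ffun=> minn x.+1 (size w).+1], grid x 0) =
  ([ffun=> minn x.+2 (size w).+1], grid x.+1 0) :> au_store Z2_model 1.
Proof.
by congr (_, _); [apply/ffunP => i; rewrite !ffunE /=; lia | exact: edge_right].
Qed.

Lemma head_init : [ffun=> 1] = [ffun=> minn 1 (size w).+1] :> {ffun 'I_1 -> nat}.
Proof. by apply/ffunP=> i; rewrite !ffunE; lia. Qed.

(** The border column [B] is where the loop stops. The final head positions [f] are left open, as
    the later rows do not consult the input. *)
Lemma check_row0_sound v s' :
  eval check_row0 (v, ([ffun=> 1], grid 0 0)) s' ->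
  exists B f, row_correct 0 B /\ s' = (v, (f, grid 0 0)).
Proof.
rewrite head_init => /eval_seqP [s1 /(eval_assertP (@au_perf_skip _ _ _ w)) [] /andP[ax]].
rewrite row0_okE => /eqP ct -> /eval_seqP [s2].
pose Inv (s : checker_vars * au_store Z2_model 1) :=
  exists x, s = (v, ([ffun=> minn x.+1 (size w).+1], grid x 0)) /\
    forall y, y <= x -> correct (config 0) y (cell y 0).
move=> /(eval_whileP (I := Inv)) [].
- move=> u1 p1 s3 [x [[-> ->] Hx]] nb /eval_seqP [s4 /eval_actP ->] /=.
  rewrite move_right_perf => /(eval_assertP (@au_perf_skip _ _ _ w)) [] /andP[nax].
  rewrite row0_okE => /eqP ct' ->; exists x.+1; split=> // y.
  rewrite leq_eqVlt => /predU1P[->|/Hx//]; split=> //; exact: negPf.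
- by exists 0; split=> // y; rewrite leqn0 => /eqP ->.
move=> [x [-> Hx]]; rewrite negbK => bd E; exists x; eexists; split.
  by split.
by apply: back_to_axis_sound E; [split | exact: leqnn].
Qed.

Definition vars_state (v : checker_vars) : tm_state T := v.1.1.1.1.

Lemma check_next_row_sound t B v f s' : row_correct t B ->
  vars_state v = tc_state (config t) ->
  eval check_next_row (v, (f, grid 0 t)) s' ->
  exists B', row_correct t.+1 B' /\
    exists2 v', vars_state v' = tc_state (config t.+1) & s' = (v', (f, grid 0 t.+1)).
Proof.
move=> [bB HB]; case: v => -[[[q r0] a0] b0] e0; rewrite /vars_state /= => ->.
move=> /eval_seqP [s1 /(eval_assertP (@au_perf_skip _ _ _ w)) [nb0 ->]].
move=> /eval_seqP [s2 /eval_actP -> /=]; rewrite au_perf_walk edge_up.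
move=> /eval_seqP [s3 /eval_actP -> /=]; rewrite au_perf_walk edge_down.
have [_ c0] := HB _ (leq0n _); rewrite c0.
set r := [ffun i => _].
(* At column [x], the cells of row [t.+1] strictly left of [x] are verified; [a] is meaningful only
   for [0 < x]. *)
pose Inv (s : checker_vars * au_store Z2_model 1) :=
  exists x a, [/\ s = ((tc_state (config t), r, a, cell x t, cell x t.+1), (f, grid x t)),
    x <= B, 0 < x -> a = cell x.-1 t &
    forall y, y < x -> correct (config t.+1) y (cell y t.+1)].
move=> /eval_seqP [s4 /(eval_whileP (I := Inv)) []].
- move=> u1 p1 s5 [x [a [[-> ->] xB Ha Hx]]] /= nb.
  (* Column [B] carries the border mark, which the loop test excludes; so the right neighbour still
     lies in the correct part of row [t]. *)
  have {}xB : x < B.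
    by rewrite ltn_neqAle xB andbT; apply: contraNneq nb => ->.
  move=> /eval_seqP [s6 /eval_actP ->] /=; rewrite au_perf_walk edge_right.
  move=> /eval_seqP [s7 /(eval_assertP (@au_perf_skip _ _ _ w)) [/= /andP[/eqP ax /eqP ct] ->]].
  move=> /eval_seqP [s8 /eval_actP -> /=]; rewrite au_perf_walk edge_up.
  move=> /eval_actP -> /=; rewrite au_perf_walk edge_down.
  exists x.+1, (cell x t); split=> // y; rewrite ltnS leq_eqVlt => /predU1P[->|/Hx//].
  split; first by rewrite ax; have [] := HB _ (ltnW xB).
  rewrite ct iterS; apply: next_contentE => //; [|exact: HB (ltnW xB)|exact: HB].
  by move=> x0; rewrite Ha //; apply: HB; lia.
- by exists 0, a0; split.
move=> [x [a [-> xB Ha Hx]]] /=; rewrite negbK => bx.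
(* The opening assertion excludes a border in column 0, so the new border column [x.-1] exists and
   is among the verified ones. *)
have x0 : 0 < x by case: (x) bx nb0 => //= ->.
move=> /eval_seqP [s6 /eval_actP ->] /=; rewrite au_perf_walk edge_up.
move=> /eval_seqP [s7 /eval_actP ->] /=; rewrite -(prednK x0) au_perf_walk edge_left.
move=> /eval_seqP [s8 /(eval_assertP (@au_perf_skip _ _ _ w)) [/= bx' ->]].
have rc : row_correct t.+1 x.-1 by split=> // y yx; apply: Hx; lia.
move=> /eval_seqP [s9 /(back_to_axis_sound rc (leqnn _)) -> /eval_actP ->].
exists x.-1; split=> //=; rewrite au_perf_skip; eexists; last by [].
rewrite /= /tm_step (_ : r = [ffun i => tc_tapes (config t) i (tc_heads (config t) i)]).
  by case: tm_trans.
by apply/ffunP=> i; rewrite !ffunE addr0.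
Qed.

Lemma check_diagram_sound v s' : vars_state v = tm_start T ->
  eval check_diagram (v, ([ffun=> 1], grid 0 0)) s' -> tm_accepts T w.
Proof.
move=> qv /eval_seqP [s1 /check_row0_sound [B [f [rc ->]]]].
pose Inv (s : checker_vars * au_store Z2_model 1) :=
  exists t B v, [/\ row_correct t B, vars_state v = tc_state (config t) &
    s = (v, (f, grid 0 t))].
move=> /(eval_whileP (I := Inv)) [].
- move=> u1 p1 s2 [t [B1 [v1 [rc1 qv1 [-> ->]]]]] _.
  by move=> /(check_next_row_sound rc1 qv1) [B2 [rc2 [v2 qv2 ->]]]; exists t.+1, B2, v2.
- by exists 0, B, v.
move=> [t [B1 [v1 [_ qv1 ->]]]] /=; rewrite negbK => acc; exists t.
by rewrite -qv1.
Qed.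

End Checking.

(** * Completeness of the checker *)

Section Completeness.
Variables (w : seq Sigma) (N : nat).

Notation config t := (iter t (@tm_step _ T) (tm_init T w)).

(** The true diagram with its border on the antidiagonal [x + t = N]. Absolute values only make it
    total on the plane; the run stays in the quadrant. *)
Definition diagram (p : mm_cell Z2_model) : diagram_cell :=
  let: (x, t) := (absz (p : int * int).1, absz (p : int * int).2) in
  (x == 0, x + t == N, view (config t) x).

Notation eval := (eval (au_obs diagram w) (au_perf w)).

Lemma back_to_axis_complete v f x t :
  eval back_to_axis (v, (f, grid x t)) (v, (f, grid 0 t)).
Proof.
elim: x => [|x IH]; first exact: EvalWhileF.
apply: EvalWhileT IH => //; apply: eval_act => //=.
by rewrite au_perf_walk edge_left.
Qed.

Lemma check_row0_complete v : exists f,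
  eval check_row0 (v, ([ffun=> 1], grid 0 0)) (v, (f, grid 0 0)).
Proof.
rewrite (head_init w); eexists; apply: EvalSeq.
  by apply: eval_assert; rewrite row0_okE eqxx.
apply: EvalSeq; last exact: back_to_axis_complete.
(* Induction on the distance [k] to the border. *)
have loop k x : x + k = N ->
    eval (While (fun _ o => ~~ border o.2)
         (Seq (Act (fun v _ => (v, ([ffun=> MoveR], Some right_gen))))
              (assert skip (fun _ o => ~~ axis o.2 && row0_ok o))))
      (v, ([ffun=> minn x.+1 (size w).+1], grid x 0))
      (v, ([ffun=> minn N.+1 (size w).+1], grid N 0)).
  elim: k x => [|k IH] x E.
    by rewrite -E addn0; apply: EvalWhileF; rewrite /border /= -E !addn0 eqxx.
  apply: (EvalWhileT _ _ (IH x.+1 _)); first by rewrite /border /=; lia.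
    apply: eval_act_seq; rewrite /= move_right_perf.
    by apply: eval_assert; rewrite row0_okE eqxx.
  by lia.
exact: (loop N 0).
Qed.

Lemma check_next_row_complete t v f : t < N ->
  vars_state v = tc_state (config t) ->
  exists2 v', vars_state v' = tc_state (config t.+1) &
    eval check_next_row (v, (f, grid 0 t)) (v', (f, grid 0 t.+1)).
Proof.
move=> tN; case: v => -[[[q r0] a0] b0] e0; rewrite /vars_state /= => ->.
pose r : {ffun I -> sym} := [ffun i => (view (config t) 0 i).1].
pose cell x s := diagram (grid x s).
have loop k x a : x + k = N - t -> (0 < x -> a = cell x.-1 t) -> exists a',
    eval (While (fun _ o => ~~ border o.2) check_cell)
      ((tc_state (config t), r, a, cell x t, cell x t.+1), (f, grid x t))
      ((tc_state (config t), r, a', cell (N - t) t, cell (N - t) t.+1),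
       (f, grid (N - t) t)).
  elim: k x a => [|k IH] x a E Ha.
    exists a; rewrite -E addn0; apply: EvalWhileF; rewrite /border /=; lia.
  have [a' Ea'] := IH x.+1 (cell x t) ltac:(lia) (fun _ => erefl).
  exists a'; apply: EvalWhileT Ea'; first by rewrite /border /=; lia.
  apply: eval_act_seq; rewrite /= au_perf_walk edge_right.
  apply: eval_assert_seq.
    rewrite eqxx /=; apply/eqP; symmetry.
    by apply: next_contentE => // x0; rewrite Ha.
  apply: eval_act_seq; rewrite /= au_perf_walk edge_up.
  by apply: eval_act => //; rewrite au_perf_walk edge_down.
have [a' Ea'] := loop (N - t) 0 a0 erefl ltac:(by []).
exists ((tm_trans (tc_state (config t)) r).1, r, a', cell (N - t) t, cell (N - t) t.+1).
  rewrite /= /tm_step (_ : r = [ffun i => tc_tapes (config t) i (tc_heads (config t) i)]).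
    by case: tm_trans.
  by apply/ffunP=> i; rewrite !ffunE addr0.
apply: eval_assert_seq; first by rewrite /border /=; lia.
apply: eval_act_seq; rewrite /= au_perf_walk edge_up.
apply: eval_act_seq; rewrite /= au_perf_walk edge_down.
apply: EvalSeq; first exact: Ea'.
apply: eval_act_seq; rewrite /= au_perf_walk edge_up.
apply: eval_act_seq; rewrite /= au_perf_walk.
have -> : mm_edge (grid (N - t) t.+1) left_gen = grid (N - t).-1 t.+1.
  by rewrite -[in RHS]edge_left prednK // subn_gt0.
apply: eval_assert_seq; first by rewrite /border /=; lia.
apply: EvalSeq; first exact: back_to_axis_complete.
by apply: eval_act => //; rewrite au_perf_skip.
Qed.

Lemma check_diagram_complete v t : vars_state v = tm_start T -> t < N ->
  tm_accept (tc_state (config t)) ->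
  exists s', eval check_diagram (v, ([ffun=> 1], grid 0 0)) s'.
Proof.
move=> qv tN acc; have [f Ef] := check_row0_complete v.
suff [s' Es'] : exists s', eval (While (fun v _ => ~~ tm_accept (v.1.1.1.1)) check_next_row)
    (v, (f, grid 0 0)) s' by exists s'; apply: EvalSeq Ef Es'.
have loop k s u : s + k = t -> vars_state u = tc_state (config s) ->
    exists s', eval (While (fun v _ => ~~ tm_accept (v.1.1.1.1)) check_next_row)
      (u, (f, grid 0 s)) s'.
  elim: k s u => [|k IH] s u E qu.
    eexists; apply: EvalWhileF; rewrite negbK -/(vars_state u) qu.
    by rewrite -(addn0 s) E.
  (* An accepting state met before time [t] ends the loop at once. *)
  case: (boolP (tm_accept (tc_state (config s)))) => accs.
    by eexists; apply: EvalWhileF; rewrite negbK -/(vars_state u) qu.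
  have sN : s < N by lia.
  have [u' qu' Eu'] := check_next_row_complete f sN qu.
  have [s' Es'] := IH s.+1 u' ltac:(lia) qu'.
  by exists s'; apply: EvalWhileT Eu' Es'; rewrite -/(vars_state u) qu.
exact: (loop t 0 v).
Qed.

End Completeness.

End TuringToAutomaton.

Lemma RE_subset_R_Z2 (Sigma : finType) (L : language Sigma) :
  RE L -> R_class Z2_model L.
Proof.
move=> [T HT].
pose d0 : diagram_cell T := (false, false, [ffun=> (None, None)]).
pose v0 : checker_vars T := (tm_start T, [ffun=> None], d0, d0, d0).
exists 1, (program_automaton (check_diagram T) v0); split=> // w.
split=> [/HT [t acc]|/program_automaton_accepts [mu [s' E]]].
  (* Size [t.+1] keeps the border off column 0 in all rows up to the accepting row [t]. *)
  apply/program_automaton_accepts; exists (@diagram _ T w t.+1).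
  exact: check_diagram_complete (ltnSn t) acc.
by apply/HT; exact: check_diagram_sound E.
Qed.

(** * Multi-stack machines as Turing machines *)

Variant stack_op (G : Type) := Keep | Pop | Push of G.
Arguments Keep {G}.
Arguments Pop {G}.

Section StackMachine.
Variables (Sigma X W V : finType).

Notation G := (Sigma + W)%type.
Notation reg := (option X).

Definition stack_store := {ffun reg -> seq G}.
Definition stack_obs_type := {ffun reg -> option G}.
Definition stack_action := {ffun reg -> stack_op G}.

Definition stack_skip : stack_action := [ffun=> Keep].

Definition stack_obs (s : stack_store) : stack_obs_type := [ffun r => ohead (s r)].

Definition apply_op (o : stack_op G) (u : seq G) : seq G :=
  match o with Keep => u | Pop => behead u | Push g => g :: u end.

Definition stack_perf (a : stack_action) (s : stack_store) : stack_store :=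
  [ffun r => apply_op (a r) (s r)].

Lemma stack_perf_skip s : stack_perf stack_skip s = s.
Proof. by apply/ffunP => r; rewrite !ffunE. Qed.

Definition stack_init (w : seq Sigma) : stack_store :=
  [ffun r => if r is None then map inl w else [::]].

Variables (c : cmd V stack_obs_type stack_action) (v0 : V).

Notation index := 'I_#|X|.+1.

(** The register [None] holds the input, hence must be the first tape. *)
Definition tape_of (r : reg) : index :=
  if r is Some x then lift ord0 (enum_rank x) else ord0.

Definition reg_of (i : index) : reg := omap enum_val (unlift ord0 i).

Lemma tape_ofK : cancel tape_of reg_of.
Proof. by case=> [x|]; rewrite /reg_of /= ?liftK ?unlift_none //= enum_rankK. Qed.

Definition push_part (o : stack_op G) : option G := if o is Push g then Some g else None.

Definition first_half (o : stack_op G) (t : option G) : option G * move :=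
  match o with
  | Keep => (t, MoveN)
  | Pop => (None, MoveR)
  | Push _ => (t, MoveL)
  end.

Notation ctl := (option (pcs c) * V)%type.

(* The stack of a register occupies the cells of its tape from the head
   rightwards, the top being under the head: the input tape is already in this
   form. A push has to move before it writes, hence two steps per operation. *)
Definition stack_tm : turing_machine Sigma :=
  @TuringMachine Sigma #|X| (ctl + ctl * {ffun reg -> option G})%type W
    (fun q t => match q with
     | inl q0 =>
       let: (q1, a) := halting_control stack_skip q0 [ffun r => t (tape_of r)] in
       (inr (q1, [ffun r => push_part (a r)]),
        [ffun i => first_half (a (reg_of i)) (t i)])
     | inr (q1, g) =>
       (inl q1, [ffun i => (if g (reg_of i) is Some x then Some x else t i, MoveN)])
     end)
    (inl (Some (entry c), v0))
    (fun q => if q is inl (None, _) then true else false).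

(** Nothing is asked of the cells left of a head: a push overwrites the cell it enters. *)
Definition represents (x : option (pcs c) * (V * stack_store))
    (z : tm_config stack_tm) :=
  tc_state z = inl (x.1, x.2.1) /\
  forall r (j : nat), tc_tapes z (tape_of r) (tc_heads z (tape_of r) + j%:Z)%R =
    onth (x.2.2 r) j.

Lemma represents_init w :
  represents (Some (entry c), (v0, stack_init w)) (tm_init stack_tm w).
Proof.
split=> // r j; rewrite !ffunE add0r; case: r => [x|] /=.
  by rewrite onth0n.
by rewrite onth_map.
Qed.

Lemma represents_step x z : represents x z ->
  represents (mstep stack_skip stack_obs stack_perf x)
    (tm_step (tm_step z)).
Proof.
case: x => p [v s] [/= Eq Et]; rewrite /mstep /=.
set o := stack_obs s.
have Eo : [ffun r => [ffun i => tc_tapes z i (tc_heads z i)] (tape_of r)] = o.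
  apply/ffunP => r; rewrite !ffunE -[tc_heads _ _]addr0 Et.
  by case: (s r).
rewrite /tm_step Eq /= Eo.
case E: (halting_control _ _ _) => [[q u] a] /=; split=> // r j.
rewrite !ffunE /= ?ffunE /= ?ffunE /= tape_ofK.
have := Et r; set h := tc_heads z _; move: (tc_tapes z _) => f Ef.
case: (a r) => [||g] /=.
- by rewrite !addr0 eqxx -Ef; case: eqP => [->|].
- rewrite addr0 addz1_add -[1%R]/(1%:Z)%R !addz_posS_neq !Ef.
  rewrite (_ : onth (behead (s r)) j = onth (s r) j.+1); last by case: (s r) j => [|? ?] [].
  by case: eqP => // /addrI [->].
rewrite addr0; case: j => [|j] /=; first by rewrite addr0 eqxx.
rewrite addz_posS_neq subz1_add Ef.
by case: eqP => // E1; rewrite -Ef E1.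
Qed.

Lemma stack_tm_accepts w :
  tm_accepts stack_tm w <->
  exists s', eval stack_obs stack_perf c (v0, stack_init w) s'.
Proof.
pose x0 := (Some (entry c), (v0, stack_init w)).
have rep t : represents (iter t (mstep stack_skip stack_obs stack_perf (c:=c)) x0)
    (iter t.*2 (@tm_step _ stack_tm) (tm_init stack_tm w)).
  elim: t => [|t IH]; first exact: represents_init.
  by rewrite doubleS !iterS; exact: represents_step.
split=> [[t]|[s' /(halts_eval stack_obs stack_perf_skip) [t Ht]]]; last first.
  by exists t.*2; have [-> _] := rep t; rewrite Ht.
(* At odd times the machine is in the middle of an operation, in a state that never accepts; even
   times are governed by [represents]. *)
rewrite -(odd_double_half t); have [] := rep t./2.
case E: (iter t./2 _ _) => [p [v s]] /= Es _; case: (odd t) => /=.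
  rewrite /tm_step Es /=.
  by case: (halting_control _ _ _) => [[q u] a].
rewrite add0n Es; case: p E {Es} => // E _.
exists (v, s); apply/(halts_eval stack_obs stack_perf_skip); by exists t./2.
Qed.

End StackMachine.

(** * Copying and erasing stacks *)

Section StackIdioms.
Variables (Sigma X W V : finType).

Notation G := (Sigma + W)%type.
Notation reg := (option X).
Notation cmd := (cmd V (stack_obs_type Sigma X W) (stack_action Sigma X W)).
Notation eval := (eval (@stack_obs Sigma X W) (@stack_perf Sigma X W)).

(** One transfer reverses the stack; a copy in the original order takes two, through an auxiliary
    register. *)
Definition transfer (a : reg) (B : pred reg) : cmd :=
  While (fun _ (o : stack_obs_type Sigma X W) => isSome (o a))
    (Act (fun v (o : stack_obs_type Sigma X W) =>
       (v, [ffun r => if r == a then Pop else if B r then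
              (if o a is Some g then Push g else Keep) else Keep] :
           stack_action Sigma X W))).

Lemma eval_transfer a (B : pred reg) v (s s' : stack_store Sigma X W) : ~~ B a ->
  (forall r, s' r = if r == a then [::] else if B r then catrev (s a) (s r) else s r) ->
  eval (transfer a B) (v, s) (v, s').
Proof.
move=> nBa; move E : (s a) => u; elim: u s E => [|g u IH] s E Hs'.
  have -> : s' = s.
    apply/ffunP => r; rewrite Hs'; case: eqP => [->|_] //.
    by case: ifP.
  by apply: EvalWhileF; rewrite !ffunE E.
apply: EvalWhileT; first by rewrite !ffunE E.
  exact: EvalAct.
apply: IH; first by rewrite !ffunE eqxx E.
move=> r; rewrite Hs' !ffunE E /=; case: eqP => // _.
by case: ifP.
Qed.

Definition erase (B : pred reg) : cmd :=
  While (fun _ (o : stack_obs_type Sigma X W) => [exists r, B r && o r])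
    (Act (fun v _ =>
       (v, [ffun r => if B r then Pop else Keep] : stack_action Sigma X W))).

(** All stacks in [B] are popped together, an empty one staying empty, so the largest height bounds
    the number of iterations. *)
Lemma eval_erase (B : pred reg) v (s s' : stack_store Sigma X W) :
  (forall r, s' r = if B r then [::] else s r) ->
  eval (erase B) (v, s) (v, s').
Proof.
move=> Hs'; have [n Hn] : exists n, forall r, B r -> size (s r) <= n.
  exists (\max_r size (s r)) => r _; exact: (leq_bigmax (F := fun r => size (s r))).
elim: n s Hn Hs' => [|n IH] s Hn Hs'.
  have s0 r : B r -> s r = [::] by move=> /Hn; rewrite leqn0 => /nilP.
  have -> : s' = s.
    by apply/ffunP => r; rewrite Hs'; case: ifP => // /s0 ->.
  apply: EvalWhileF; apply/existsPn => r; rewrite !ffunE.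
  by case Br: (B r) => //=; rewrite s0.
case: (boolP [exists r, B r && stack_obs s r]) => [He|Hne].
  apply: EvalWhileT => //; first exact: EvalAct.
  apply: IH => r; rewrite ?Hs' !ffunE /=.
    by move=> Br; rewrite Br /= size_behead; have := Hn r Br; case: (size _).
  by case: ifP.
suff -> : s' = s by exact: EvalWhileF.
apply/ffunP => r; rewrite Hs'; case: ifP => // Br.
by move/existsPn: Hne => /(_ r); rewrite Br ffunE /=; case: (s r).
Qed.

End StackIdioms.
Arguments transfer {Sigma X W V}.
Arguments erase {Sigma X W V}.

(** * Enumeration of all words over a finite alphabet *)

Section Odometer.
Variables (D : finType) (d0 : D).

Definition digit_first : D := head d0 (enum D).
Definition digit_succ (x : D) : option D := onth (enum D) (index x (enum D)).+1.

(* Successor in bijective base [#|D|], least significant digit first: unlike in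
   positional notation, every word is reached. *)
Fixpoint next_word (s : seq D) : seq D :=
  if s is x :: s' then
    if digit_succ x is Some y then y :: s' else digit_first :: next_word s'
  else [:: digit_first].

Fixpoint word_value (s : seq D) : nat :=
  if s is x :: s' then (index x (enum D)).+1 + #|D| * word_value s' else 0.

Lemma index_lt_card (x : D) : index x (enum D) < #|D|.
Proof. by rewrite cardE index_mem mem_enum. Qed.

Lemma index_digit_first : index digit_first (enum D) = 0.
Proof.
rewrite /digit_first; case E: (enum D) => [|x s] //=; last by rewrite eqxx.
Qed.

Lemma word_value_next s : word_value (next_word s) = (word_value s).+1.
Proof.
elim: s => [|x s IH] /=; first by rewrite index_digit_first muln0.
have := index_lt_card x; case E: (digit_succ x) => [y|] /= lt.
  rewrite -(onth_nth x _ _ _ E) index_uniq ?enum_uniq //.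
  by have := congr1 isSome E; rewrite onthTE.
(* A digit without successor is the last one and counts [#|D|]; setting it back to 1 is compensated
   by the carry. *)
have := congr1 isSome E; rewrite onthTE -cardE /= => /negbT.
by rewrite -leqNgt index_digit_first IH; nia.
Qed.

Lemma word_value_inj : injective word_value.
Proof.
elim=> [|x s IH] [|y t] //=; rewrite !addSn => -[E].
have D0 : 0 < #|D| by apply/card_gt0P; exists x.
have Ex : index x (enum D) = index y (enum D).
  have := congr1 (modn^~ #|D|) E.
  by rewrite ![_ + #|D| * _]addnC ![#|D| * _]mulnC !modnMDl !modn_small // index_lt_card.
rewrite Ex in E; move/addnI: E => /eqP; rewrite eqn_mul2l gtn_eqF //= => /eqP /IH ->.
by rewrite -(nth_index x (mem_enum D x)) Ex nth_index ?mem_enum.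
Qed.

(** Each successor raises [word_value] by one from 0, so after [word_value s] of them injectivity
    gives [s]. *)
Lemma next_word_surj s : exists n, iter n next_word [::] = s.
Proof.
exists (word_value s); apply: word_value_inj.
by elim: (word_value s) => //= n IH; rewrite word_value_next IH.
Qed.

End Odometer.

(** * From automata to Turing machines *)

(** An optional sign for each coordinate, so that each component drives one counter. *)
Definition direction := (option bool * option bool)%type.

Definition sign_val (o : option bool) : int :=
  match o with None => 0 | Some true => 1 | Some false => -1 end%R.

Definition sign_of (z : int) : option bool :=
  if z == 1%R then Some true else if z == (-1)%R then Some false else None.

Definition direction_of (g : option (mm_label Z2_model)) : direction :=
  if g is Some a then (sign_of (val a : int * int).1, sign_of (val a : int * int).2)
  else (None, None).

Definition move_by (p : int * int) (d : direction) : int * int :=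
  (p.1 + sign_val d.1, p.2 + sign_val d.2)%R.

Definition move_back (p : int * int) (d : direction) : int * int :=
  (p.1 - sign_val d.1, p.2 - sign_val d.2)%R.

Lemma move_byK p d : move_back (move_by p d) d = p.
Proof. by case: p => x y; rewrite /move_back /= !addrK. Qed.

Lemma move_by_direction_of (p : mm_cell Z2_model) g :
  (if g is Some a then mm_edge p a else p) = move_by p (direction_of g).
Proof.
case: g => [[a Ha]|]; last by case: p => x y; rewrite /move_by /= !addr0.
rewrite /mm_edge mulZ2E /move_by /=.
by move: Ha; rewrite !inE => /or4P[] /eqP ->.
Qed.

(** * Runs on guessed reads *)

Section GuessedReads.
Variables (Sigma : finType) (h : nat) (A : automaton Sigma Z2_model h) (w : seq Sigma).

Notation D := (au_mem A).
Notation history := (seq (D * direction)).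

(** The history has the newest read first, and each cell is recovered from the current one by
    undoing moves, so no coordinates are stored. *)
Fixpoint visits (p : int * int) (hs : history) : seq ((int * int) * D) :=
  if hs is (x, d) :: hs' then (move_back p d, x) :: visits (move_back p d) hs'
  else [::].

(* [(a, b)] is the displacement from the cell reached after the moves of [hs] to
   the cell where [x] is read; the latest entry of [hs] was read in that same
   cell iff the displacement extended by its move vanishes. *)
Fixpoint agrees (x : D) (a b : int) (hs : history) : bool :=
  if hs is (y, d) :: hs' then
    let a' := (a + sign_val d.1)%R in let b' := (b + sign_val d.2)%R in
    ((a' == 0%R) && (b' == 0%R) ==> (y == x)) && agrees x a' b' hs'
  else true.

Lemma agreesE x (p : int * int) a b hs :
  agrees x a b hs =
  all (fun e => (e.1 == p) ==> (e.2 == x)) (visits (p.1 - a, p.2 - b)%R hs).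
Proof.
elim: hs a b => //= -[y d] hs IH a b; rewrite IH /move_back /= -!addrA -!opprD.
congr (_ && _); congr (_ ==> _).
case: p {IH} => u v; rewrite xpair_eqE /=.
have E (z s : int) : (z - s == z)%R = (s == 0)%R.
  by rewrite subr_eq addrC -subr_eq subrr eq_sym.
by rewrite !E.
Qed.

Record guess_state := GuessState {
  gs_config : au_config A; gs_history : history; gs_ok : bool }.

Definition read_move (c : au_config A) (x : D) :=
  au_trans (ac_state c) [ffun i => input_at w (ac_heads c i)] x.

(** A step consults the memory in the current cell only, hence the constant memory [x]. An
    inconsistent guess is noted in [gs_ok] and the run goes on. *)
Definition feed (g : guess_state) (x : D) : guess_state :=
  let c := gs_config g in
  GuessState (au_step (fun=> x) w c)
    ((x, direction_of (read_move c x).2) :: gs_history g)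
    (gs_ok g && agrees x 0 0 (gs_history g)).

Definition guess_init := GuessState (au_init A) [::] true.

Definition guess_run (ds : seq D) := foldl feed guess_init ds.

Definition gs_visits (g : guess_state) := visits (ac_cell (gs_config g)) (gs_history g).

Lemma visits_feed g x :
  gs_visits (feed g x) = ((ac_cell (gs_config g) : int * int), x) :: gs_visits g.
Proof.
rewrite /gs_visits /feed /= /au_step -/(read_move _ _).
case: (read_move _ _) => [[q mv] d] /=; rewrite move_by_direction_of.
by rewrite move_byK.
Qed.

Lemma ok_feed g x : gs_ok (feed g x) = gs_ok g &&
  all (fun e => (e.1 == ac_cell (gs_config g)) ==> (e.2 == x)) (gs_visits g).
Proof.
rewrite /= (agreesE _ (ac_cell (gs_config g))) /gs_visits.
by case: (ac_cell _) => u v; rewrite !subr0.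
Qed.

Definition guess_accepting (ds : seq D) : bool :=
  gs_ok (guess_run ds) && au_accept (ac_state (gs_config (guess_run ds))).

Lemma guess_run_rcons ds x : guess_run (rcons ds x) = feed (guess_run ds) x.
Proof. by rewrite /guess_run -cats1 foldl_cat. Qed.

Lemma guess_run_mu ds (mu : mm_cell Z2_model -> D) :
  {in gs_visits (guess_run ds), forall e, mu e.1 = e.2} ->
  gs_config (guess_run ds) = iter (size ds) (au_step mu w) (au_init A).
Proof.
elim/last_ind: ds => // ds x IH; rewrite guess_run_rcons size_rcons visits_feed => Hmu.
have E : gs_config (guess_run ds) = iter (size ds) (au_step mu w) (au_init A).
  by apply: IH => e He; apply: Hmu; rewrite inE He orbT.
rewrite iterS -E /= /au_step; set c := gs_config _.
by rewrite (Hmu (ac_cell c : int * int, x)) // inE eqxx.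
Qed.

(** Every read was compared with all earlier reads in its cell, so the visits form the graph of a
    partial memory content. *)
Lemma guess_run_functional ds : gs_ok (guess_run ds) ->
  {in gs_visits (guess_run ds) &, forall e f, e.1 = f.1 -> e.2 = f.2}.
Proof.
elim/last_ind: ds => // ds x IH; rewrite guess_run_rcons ok_feed visits_feed.
move=> /andP[/IH H /allP Hx] e f; rewrite !inE.
move=> /predU1P[->|He] /predU1P[->|Hf] //=; last exact: H.
  by move=> E; apply/esym/eqP; move/implyP: (Hx f Hf); apply; rewrite E.
by move=> E; apply/eqP; move/implyP: (Hx e He); apply; rewrite E.
Qed.

Lemma guess_accepting_sound (d0 : D) ds : guess_accepting ds -> au_accepts A w.
Proof.
move=> /andP[ok acc].
(* Each visited cell gets a read recorded for it; cells never visited get the default [d0]. *)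
pose mu (p : mm_cell Z2_model) : D :=
  (nth ((0, 0)%R, d0) (gs_visits (guess_run ds))
     (find (fun e => e.1 == (p : int * int)) (gs_visits (guess_run ds)))).2.
exists mu, (size ds); rewrite -guess_run_mu // => e He.
have Hh : has (fun f => f.1 == e.1) (gs_visits (guess_run ds)).
  by apply/hasP; exists e.
apply: (guess_run_functional ok) => //; first by rewrite mem_nth // -has_find.
exact/eqP/(nth_find ((0, 0)%R, d0) Hh).
Qed.

Lemma guess_accepting_complete : au_accepts A w -> exists ds, guess_accepting ds.
Proof.
move=> [mu [t acc]].
suff [ds [Ec ok _]] : exists ds,
    [/\ gs_config (guess_run ds) = iter t (au_step mu w) (au_init A),
        gs_ok (guess_run ds) &
        {in gs_visits (guess_run ds), forall e, e.2 = mu e.1}].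
  by exists ds; rewrite /guess_accepting ok Ec.
elim: t {acc} => [|t [ds [Ec ok Hv]]]; first by exists [::].
(* The right guess is what [mu] holds in the current cell. *)
exists (rcons ds (mu (ac_cell (gs_config (guess_run ds))))).
rewrite guess_run_rcons visits_feed ok_feed ok; split.
- by rewrite iterS -Ec.
- by apply/allP => e /Hv He; apply/implyP => /eqP <-; rewrite He.
by move=> e; rewrite inE => /predU1P[->|/Hv].
Qed.

End GuessedReads.

(** [Word] is the sequence under trial and [Guess] its unread part; [Hist] is the history, parked in
    [Past] during a scan; the counters hold the displacement; [HeadL] and [HeadR] hold the input on
    the two sides of a head. *)
Inductive sim_reg (h : nat) :=
  Tmp | Word | Guess | Hist | Past | CountX | CountY | HeadL of 'I_h | HeadR of 'I_h.
Arguments Tmp {h}.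
Arguments Word {h}.
Arguments Guess {h}.
Arguments Hist {h}.
Arguments Past {h}.
Arguments CountX {h}.
Arguments CountY {h}.

Definition sim_reg_code h (r : sim_reg h) : 'I_7 + ('I_h + 'I_h) :=
  match r with
  | Tmp => inl (@Ordinal 7 0 isT) | Word => inl (@Ordinal 7 1 isT) | Guess => inl (@Ordinal 7 2 isT)
  | Hist => inl (@Ordinal 7 3 isT) | Past => inl (@Ordinal 7 4 isT)
  | CountX => inl (@Ordinal 7 5 isT) | CountY => inl (@Ordinal 7 6 isT)
  | HeadL i => inr (inl i) | HeadR i => inr (inr i)
  end.

Definition sim_reg_decode h (c : 'I_7 + ('I_h + 'I_h)) : sim_reg h :=
  match c with
  | inl k => nth CountY [:: Tmp; Word; Guess; Hist; Past; CountX; CountY] k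
  | inr (inl i) => HeadL i
  | inr (inr i) => HeadR i
  end.

Lemma sim_reg_codeK h : cancel (@sim_reg_code h) (@sim_reg_decode h).
Proof. by case. Qed.

HB.instance Definition _ h := Equality.copy (sim_reg h) (can_type (@sim_reg_codeK h)).
HB.instance Definition _ h := Choice.copy (sim_reg h) (can_type (@sim_reg_codeK h)).
HB.instance Definition _ h := Countable.copy (sim_reg h) (can_type (@sim_reg_codeK h)).
HB.instance Definition _ h := Finite.copy (sim_reg h) (can_type (@sim_reg_codeK h)).

(* A head at position [p > 0] splits the input into the letters before it, as a
   stack with the nearest on top, and the rest; at [p = 0] the split is that of
   [p = 1], and [at_left] tells them apart. *)
Section HeadStacks.
Variables (Sigma : Type) (W : Type).
Notation G := (Sigma + W)%type.

Definition left_part (w : seq Sigma) (p : nat) : seq Sigma := rev (take p.-1 w).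
Definition right_part (w : seq Sigma) (p : nat) : seq Sigma := drop p.-1 w.

Definition head_symbol (at_left : bool) (r : option G) : input_symbol Sigma :=
  if at_left then LeftEnd else if r is Some (inl a) then Letter a else RightEnd.

(** Between positions 0 and 1 only the flag changes; an empty right stack means the right endmarker
    and blocks a right move. *)
Definition head_ops (at_left : bool) (l r : option G) (m : move) :
    stack_op G * stack_op G * bool :=
  match m with
  | MoveN => (Keep, Keep, at_left)
  | MoveL => if at_left then (Keep, Keep, true) else
             if l is Some g then (Pop, Push g, false) else (Keep, Keep, true)
  | MoveR => if at_left then (Keep, Keep, false) else
             if r is Some g then (Push g, Pop, false) else (Keep, Keep, false)
  end.

End HeadStacks.

Section HeadStacksTheory.
Variables (Sigma W : finType).
Notation G := (Sigma + W)%type.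

Lemma head_symbolE (w : seq Sigma) p :
  head_symbol (p == 0) (ohead (map inl (right_part w p)) : option G) = input_at w p.
Proof.
case: p => [|p] //=; rewrite /head_symbol /right_part /=.
case: (ltnP p (size w)) => lt; last by rewrite drop_oversize ?onth_default.
case: w lt => // a w lt; rewrite (drop_nth a) //=.
by rewrite onthE (nth_map a).
Qed.

Lemma head_opsE (w : seq Sigma) p m : p <= (size w).+1 ->
  let: (l, r, b) := head_ops (p == 0) (ohead (map inl (left_part w p)))
                      (ohead (map inl (right_part w p)) : option G) m in
  let p' := move_head (size w) p m in
  [/\ apply_op l (map inl (left_part w p)) = map inl (left_part w p'),
      apply_op r (map inl (right_part w p)) = map inl (right_part w p') &
      b = (p' == 0)].
Proof.
move=> lep; case: m => /=; last first.
- case: p lep => [|p] lep /=; first by rewrite minnSS min0n.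
  rewrite /left_part /right_part /= minnSS.
  case: (ltnP p (size w)) => lt; last first.
    by rewrite drop_oversize // (_ : minn p.+1 (size w) = p) //=; [rewrite drop_oversize | lia].
  rewrite (minn_idPl _) //=; case: w lt lep => // a w lt lep.
  by rewrite (take_nth a) // rev_rcons (drop_nth a) //.
- by [].
case: p lep => [|[|p]] lep //=; first by rewrite /left_part /right_part /= take0.
rewrite /left_part /right_part /=.
case: w lep => // a w lep; rewrite (take_nth a) // rev_rcons /=.
by rewrite (drop_nth a (lep : p < size (a :: w))).
Qed.

End HeadStacksTheory.

(** * Integers as unary stacks *)

Section CounterStack.
Local Open Scope ring_scope.

(** Every symbol carries the sign, and zero is recognized as the empty stack. *)
Definition counter_stack (z : int) : seq bool :=
  match z with Posz n => nseq n true | Negz n => nseq n.+1 false end.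

Definition counter_op (o t : option bool) : stack_op bool :=
  match o, t with
  | None, _ => Keep
  | Some b, None => Push b
  | Some b, Some b' => if b == b' then Push b else Pop
  end.

Definition map_op (T U : Type) (f : T -> U) (o : stack_op T) : stack_op U :=
  match o with Keep => Keep | Pop => Pop | Push x => Push (f x) end.

Lemma counter_opE (Sigma W : finType) (f : bool -> Sigma + W) z o :
  apply_op (map_op f (counter_op o (ohead (counter_stack z)))) (map f (counter_stack z)) =
  map f (counter_stack (z + sign_val o)).
Proof.
case: o => [b|] /=; last by rewrite addr0.
have succ n : Posz n + 1 = Posz n.+1 by lia.
have pred n : Posz n.+1 + -1 = Posz n by lia.
have nsucc n : Negz n.+1 + 1 = Negz n by lia.
have npred n : Negz n + -1 = Negz n.+1 by lia.
case: z => [[|n]|[|n]]; case: b; rewrite /sign_val ?succ ?pred ?nsucc ?npred //.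
Qed.

Lemma counter_stack_nil z : isSome (ohead (counter_stack z)) = (z != 0).
Proof. by case: z => [[|n]|n]. Qed.

End CounterStack.

(** * The simulating program *)

Section AutomatonToTuring.
Variables (Sigma : finType) (h : nat) (A : automaton Sigma Z2_model h).
Variable d0 : au_mem A.

Notation D := (au_mem A).
Notation entry_type := (D * (option bool * option bool))%type.

Definition sim_work : finType := (D + entry_type + bool)%type.

Notation G := (Sigma + sim_work)%type.
Notation reg := (option (sim_reg h)).
Notation obs_type := (stack_obs_type Sigma (sim_reg h) sim_work).
Notation action := (stack_action Sigma (sim_reg h) sim_work).
Notation store := (stack_store Sigma (sim_reg h) sim_work).
Notation skip := (stack_skip Sigma (sim_reg h) sim_work).

Definition digit_sym (x : D) : G := inr (inl (inl x)).
Definition entry_sym (e : entry_type) : G := inr (inl (inr e)).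
Definition count_sym (b : bool) : G := inr (inr b).

Definition as_digit (o : option G) : D :=
  if o is Some (inr (inl (inl x))) then x else d0.
Definition as_entry (o : option G) : entry_type :=
  if o is Some (inr (inl (inr e))) then e else (d0, (None, None)).
Definition as_count (o : option G) : option bool :=
  if o is Some (inr (inr b)) then Some b else None.

(* state, consistency flag, success flag, current read, recorded read, and for
   each head whether it is on the left endmarker *)
Definition sim_vars : finType :=
  (au_state A * bool * bool * D * D * {ffun 'I_h -> bool})%type.

Notation cmd := (cmd sim_vars obs_type action).
Notation eval := (eval (@stack_obs Sigma (sim_reg h) sim_work)
                       (@stack_perf Sigma (sim_reg h) sim_work)).

(** The second transfer restores the input and copies it to the right stack of every head, which
    puts all heads on position 1. *)
Definition load_input : cmd :=
  Seq (transfer None (pred1 (Some Tmp)))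
      (transfer (Some Tmp) (fun r => match r with
        | None | Some (HeadR _) => true | _ => false end)).

Definition load_guess : cmd :=
  Seq (transfer (Some Word) (pred1 (Some Tmp)))
      (transfer (Some Tmp) (pred2 (Some Word) (Some Guess))).

Definition reset : cmd := Act (fun (v : sim_vars) (_ : obs_type) =>
  let: (q, ok, fnd, cur, prev, fl) := v in
  ((au_start A, true, fnd, cur, prev, [ffun=> false]), skip)).

Definition fetch : cmd := Act (fun (v : sim_vars) (o : obs_type) =>
  let: (q, ok, fnd, cur, prev, fl) := v in
  ((q, ok, fnd, as_digit (o (Some Guess)), prev, fl),
   [ffun r => if r == Some Guess then Pop else Keep] : action)).

Definition scan_entry : cmd := Act (fun (v : sim_vars) (o : obs_type) =>
  let: (q, ok, fnd, cur, prev, fl) := v in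
  let: (y, d) := as_entry (o (Some Hist)) in
  ((q, ok, fnd, cur, y, fl),
   [ffun r : reg => match r with
    | Some Hist => Pop
    | Some Past => Push (entry_sym (y, d))
    | Some CountX => map_op count_sym (counter_op d.1 (as_count (o (Some CountX))))
    | Some CountY => map_op count_sym (counter_op d.2 (as_count (o (Some CountY))))
    | _ => Keep
    end] : action)).

(** A separate action, since the zero test must see the counters as updated by [scan_entry]. *)
Definition compare_entry : cmd := Act (fun (v : sim_vars) (o : obs_type) =>
  let: (q, ok, fnd, cur, prev, fl) := v in
  ((q, ok && (~~ o (Some CountX) && ~~ o (Some CountY) ==> (prev == cur)),
    fnd, cur, prev, fl), skip)).

Definition scan : cmd :=
  While (fun _ (o : obs_type) => isSome (o (Some Hist))) (Seq scan_entry compare_entry).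

Definition act : cmd := Act (fun (v : sim_vars) (o : obs_type) =>
  let: (q, ok, fnd, cur, prev, fl) := v in
  let: (q', mv, g) :=
    au_trans q [ffun i => head_symbol (fl i) (o (Some (HeadR i)))] cur in
  let ops i := head_ops (fl i) (o (Some (HeadL i))) (o (Some (HeadR i))) (mv i) in
  ((q', ok, fnd, cur, prev, [ffun i => (ops i).2]),
   [ffun r : reg => match r with
    | Some Hist => Push (entry_sym (cur, direction_of g))
    | Some (HeadL i) => (ops i).1.1
    | Some (HeadR i) => (ops i).1.2
    | _ => Keep
    end] : action)).

Definition round : cmd :=
  Seq fetch (Seq scan (Seq (transfer (Some Past) (pred1 (Some Hist)))
    (Seq (erase (pred2 (Some CountX) (Some CountY))) act))).

Definition judge : cmd := Act (fun (v : sim_vars) (_ : obs_type) =>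
  let: (q, ok, fnd, cur, prev, fl) := v in
  ((q, ok, ok && au_accept q, cur, prev, fl), skip)).

Definition clean : cmd := erase (fun r => match r with
  | Some Hist | Some (HeadL _) | Some (HeadR _) => true | _ => false end).

Definition carry : cmd :=
  While (fun _ (o : obs_type) => isSome (o (Some Word)) && ~~ digit_succ (as_digit (o (Some Word))))
    (Act (fun (v : sim_vars) (_ : obs_type) => (v, [ffun r : reg => match r with
      | Some Word => Pop
      | Some Tmp => Push (digit_sym (digit_first d0))
      | _ => Keep end] : action))).

Definition pop_word : cmd := Act (fun (v : sim_vars) (o : obs_type) =>
  let: (q, ok, fnd, cur, prev, fl) := v in
  ((q, ok, fnd, (if isSome (o (Some Word)) then
      odflt d0 (digit_succ (as_digit (o (Some Word)))) else digit_first d0), prev, fl),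
   [ffun r => if r == Some Word then Pop else Keep] : action)).

Definition push_word : cmd := Act (fun (v : sim_vars) (o : obs_type) =>
  let: (q, ok, fnd, cur, prev, fl) := v in
  (v, [ffun r => if r == Some Word then Push (digit_sym cur) else Keep] : action)).

(** An iterative [next_word]: [carry] parks the reset digits on [Tmp], [pop_word] computes the digit
    where the carry stops, a new one if the word is exhausted, and the transfer brings the parked
    digits back. *)
Definition advance : cmd :=
  Seq carry (Seq pop_word (Seq push_word (transfer (Some Tmp) (pred1 (Some Word))))).

Definition attempt : cmd :=
  Seq load_input (Seq load_guess (Seq reset
    (Seq (While (fun _ (o : obs_type) => isSome (o (Some Guess))) round)
      (Seq judge (Seq clean advance))))).

Definition found (v : sim_vars) : bool := v.1.1.1.2.

Definition search : cmd := While (fun v _ => ~~ found v) attempt.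

Definition sim_store (w : seq Sigma) (tmp : seq G) (word guess : seq D)
    (hist past : seq entry_type) (x y : int) (hl hr : 'I_h -> seq Sigma) : store :=
  [ffun r : reg => match r with
   | None => map inl w
   | Some Tmp => tmp
   | Some Word => map digit_sym word
   | Some Guess => map digit_sym guess
   | Some Hist => map entry_sym hist
   | Some Past => map entry_sym past
   | Some CountX => map count_sym (counter_stack x)
   | Some CountY => map count_sym (counter_stack y)
   | Some (HeadL i) => map inl (hl i)
   | Some (HeadR i) => map inl (hr i)
   end].

Lemma ohead_map (T U : Type) (f : T -> U) s : ohead (map f s) = omap f (ohead s).
Proof. by case: s. Qed.

(** Induction on the history, for arbitrary displacement and parked entries. The final counters are
    left open, as [round] erases them. *)
Lemma eval_scan w tmp word guess hist past x y hl hr q ok fnd cur prev fl :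
  exists x' y' prev',
  eval scan
    ((q, ok, fnd, cur, prev, fl), sim_store w tmp word guess hist past x y hl hr)
    ((q, ok && agrees cur x y hist, fnd, cur, prev', fl),
     sim_store w tmp word guess [::] (catrev hist past) x' y' hl hr).
Proof.
elim: hist past x y ok prev => [|[z d] hist IH] past x y ok prev.
  exists x, y, prev; rewrite andbT; apply: EvalWhileF.
  by rewrite !ffunE.
set x1 := (x + sign_val d.1)%R; set y1 := (y + sign_val d.2)%R.
have [x' [y' [prev' E]]] := IH ((z, d) :: past) x1 y1
  (ok && ((x1 == 0%R) && (y1 == 0%R) ==> (z == cur))) z.
exists x', y', prev'; apply: EvalWhileT; first by rewrite !ffunE.
  apply: eval_act_seq; rewrite /= !ffunE /=.
  exact: EvalAct.
rewrite /= andbA stack_perf_skip.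
have -> : stack_perf
   [ffun r : reg => match r with
    | Some Hist => Pop
    | Some Past => Push (entry_sym (z, d))
    | Some CountX => map_op count_sym (counter_op d.1
         (as_count (ohead [seq count_sym i | i <- counter_stack x])))
    | Some CountY => map_op count_sym (counter_op d.2
         (as_count (ohead [seq count_sym i | i <- counter_stack y])))
    | _ => Keep
    end] (sim_store w tmp word guess ((z, d) :: hist) past x y hl hr) =
   sim_store w tmp word guess hist ((z, d) :: past) x1 y1 hl hr.
  have asE u : as_count (ohead [seq count_sym i | i <- counter_stack u]) =
      ohead (counter_stack u) by case: (counter_stack u).
  by apply/ffunP => -[[|||||||i|i]|]; rewrite !ffunE //= asE counter_opE.
rewrite !ffunE !ohead_map.
have isE u : isSome (omap count_sym (ohead (counter_stack u))) = (u != 0%R).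
  by rewrite -counter_stack_nil; case: (counter_stack u).
by rewrite !isE !negbK; exact: E.
Qed.

(** * Correctness of the simulation *)

Section Simulation.
Variable w : seq Sigma.

Definition vars_of (g : guess_state A) (fnd : bool) (cur prev : D) : sim_vars :=
  (ac_state (gs_config g), gs_ok g, fnd, cur, prev,
   [ffun i => ac_heads (gs_config g) i == 0]).

Definition store_of (word guess : seq D) (g : guess_state A) : store :=
  sim_store w [::] word guess (gs_history g) [::] 0 0
    (fun i => left_part w (ac_heads (gs_config g) i))
    (fun i => right_part w (ac_heads (gs_config g) i)).

Definition heads_in_range (g : guess_state A) :=
  forall i, ac_heads (gs_config g) i <= (size w).+1.

Lemma heads_in_range_feed g x : heads_in_range g -> heads_in_range (feed w g x).
Proof.
move=> Hg i; rewrite /= /au_step.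
case: (au_trans _ _ _) => [[q mv] d] /=; rewrite ffunE.
have := Hg i; case: (mv i) => //= le; first exact: leq_trans (leq_pred _) le.
exact: geq_minr.
Qed.

(** The scan has already put the consistency test of [feed] into the flag; [act] supplies the rest
    of the step. *)
Lemma eval_act_feed g x word guess fnd prev : heads_in_range g ->
  eval act
    ((ac_state (gs_config g), gs_ok g && agrees x 0 0 (gs_history g), fnd, x, prev,
      [ffun i => ac_heads (gs_config g) i == 0]), store_of word guess g)
    (vars_of (feed w g x) fnd x prev, store_of word guess (feed w g x)).
Proof.
move=> Hg.
have symE : [ffun i => head_symbol ([ffun i => ac_heads (gs_config g) i == 0] i)
      (stack_obs (store_of word guess g) (Some (HeadR i)))] =
    [ffun i => input_at w (ac_heads (gs_config g) i)].
  by apply/ffunP => i; rewrite !ffunE head_symbolE.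
rewrite /vars_of /store_of /feed /= /read_move /au_step.
case E: (au_trans _ _ _) => [[q mv] d] /=.
apply: eval_act => /=; rewrite symE E.
  congr (_, _); apply/ffunP => i; rewrite !ffunE.
  by have := head_opsE sim_work (mv i) (Hg i); case: (head_ops _ _ _ _) => [[l r] b] [].
apply/ffunP => -[[|||||||i|i]|]; rewrite !ffunE //= ?ffunE //;
by have := head_opsE sim_work (mv i) (Hg i); case: (head_ops _ _ _ _) => [[l r] b] [].
Qed.

Lemma eval_round g x word guess fnd cur prev : heads_in_range g ->
  exists prev',
  eval round (vars_of g fnd cur prev, store_of word (x :: guess) g)
    (vars_of (feed w g x) fnd x prev', store_of word guess (feed w g x)).
Proof.
move=> Hg.
have [x' [y' [prev' E]]] := eval_scan w [::] word guess (gs_history g) [::] 0 0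
  (fun i => left_part w (ac_heads (gs_config g) i))
  (fun i => right_part w (ac_heads (gs_config g) i))
  (ac_state (gs_config g)) (gs_ok g) fnd x prev
  [ffun i => ac_heads (gs_config g) i == 0].
exists prev'; apply: eval_act_seq; rewrite /= !ffunE /=.
have -> : stack_perf [ffun r => if r == Some Guess then Pop else Keep]
    (store_of word (x :: guess) g) = store_of word guess g.
  by apply/ffunP => -[[|||||||i|i]|]; rewrite !ffunE.
apply: EvalSeq E _.
apply: (EvalSeq (s1 := (_, sim_store w [::] word guess (gs_history g) [::] x' y'
  (fun i => left_part w (ac_heads (gs_config g) i))
  (fun i => right_part w (ac_heads (gs_config g) i))))).
  apply: eval_transfer => // -[[|||||||i|i]|]; rewrite !ffunE //=.
  by rewrite catrevE cats0 -map_rev revK.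
apply: (EvalSeq (s1 := (_, store_of word guess g))); last exact: eval_act_feed.
by apply: eval_erase => -[[|||||||i|i]|]; rewrite !ffunE.
Qed.

Lemma eval_rounds g word guess fnd cur prev : heads_in_range g ->
  exists cur' prev',
  eval (While (fun _ (o : obs_type) => isSome (o (Some Guess))) round)
    (vars_of g fnd cur prev, store_of word guess g)
    (vars_of (foldl (feed w) g guess) fnd cur' prev',
     store_of word [::] (foldl (feed w) g guess)).
Proof.
elim: guess g cur prev => [|x guess IH] g cur prev Hg.
  by exists cur, prev; apply: EvalWhileF; rewrite !ffunE.
have [prev1 E1] := eval_round x word guess fnd cur prev Hg.
have [cur' [prev' E]] := IH _ x prev1 (heads_in_range_feed x Hg).
by exists cur', prev'; apply: EvalWhileT E1 E; rewrite !ffunE.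
Qed.

Definition idle_store (tmp : seq G) (word : seq D) : store :=
  sim_store w tmp word [::] [::] [::] 0 0 (fun=> [::]) (fun=> [::]).

Lemma eval_push_word q ok fnd cur prev fl t word :
  let v : sim_vars := (q, ok, fnd, cur, prev, fl) in
  eval (Seq push_word (transfer (Some Tmp) (pred1 (Some Word))))
    (v, idle_store (map digit_sym t) word)
    (v, idle_store [::] (catrev t (cur :: word))).
Proof.
apply: eval_act_seq => /=.
apply: eval_transfer => // -[[|||||||i|i]|]; rewrite !ffunE //= ?ffunE //.
by rewrite !catrevE map_cat map_rev.
Qed.

(** The parked digits [t] are arbitrary, so that a carry adds the reset digit to [t] and recurses on
    the rest. *)
Lemma eval_advance v t word :
  exists2 v', found v' = found v &
  eval advance (v, idle_store (map digit_sym t) word)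
    (v', idle_store [::] (catrev t (next_word d0 word))).
Proof.
case: v => -[[[[q ok] fnd] cur] prev] fl.
elim: word t => [|x word IH] t /=.
  eexists; last first.
    apply: EvalSeq; first by apply: EvalWhileF; rewrite !ffunE.
    apply: eval_act_seq; rewrite /= !ffunE /=.
    have -> : stack_perf [ffun r => if r == Some Word then Pop else Keep]
        (idle_store (map digit_sym t) [::]) = idle_store (map digit_sym t) [::].
      by apply/ffunP => -[[|||||||i|i]|]; rewrite !ffunE.
    exact: eval_push_word.
  by [].
case E: (digit_succ x) => [y|].
  eexists; last first.
    apply: EvalSeq; first by apply: EvalWhileF; rewrite !ffunE /= E.
    apply: eval_act_seq; rewrite /= !ffunE /= E /=.
    have -> : stack_perf [ffun r => if r == Some Word then Pop else Keep]
        (idle_store (map digit_sym t) (x :: word)) = idle_store (map digit_sym t) word.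
      by apply/ffunP => -[[|||||||i|i]|]; rewrite !ffunE.
    exact: eval_push_word.
  by [].
have [v' fv' Ev'] := IH (digit_first d0 :: t).
(* The recursive evaluation is cut after [carry] in order to put one more iteration in front of that
   loop. *)
exists v' => //; have [s1 E1 E2] := eval_seqP Ev'.
apply: EvalSeq E2; apply: EvalWhileT E1; first by rewrite !ffunE /= E.
apply: eval_act => //.
by apply/ffunP => -[[|||||||i|i]|]; rewrite !ffunE.
Qed.

(** An attempt consumes a finite word and so terminates whatever its outcome; attempts can thus run
    one after the other without dovetailing. *)
Lemma eval_attempt v word :
  exists2 v', found v' = guess_accepting w word &
  eval attempt (v, idle_store [::] word) (v', idle_store [::] (next_word d0 word)).
Proof.
case: v => -[[[[q ok] fnd] cur] prev] fl.
pose g0 := guess_init A.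
have Hg0 : heads_in_range g0 by move=> i; rewrite ffunE.
have [cur' [prev' Er]] := eval_rounds word word fnd cur prev Hg0.
pose v1 : sim_vars := vars_of (guess_run w word) (guess_accepting w word) cur' prev'.
have [v' fv' Ev'] := eval_advance v1 [::] word.
exists v'; first by rewrite fv'.
apply: (EvalSeq (s1 := (_, sim_store w [::] word [::] [::] [::] 0 0 (fun=> [::]) (fun=> w)))).
  apply: (EvalSeq (s1 := (_, sim_store [::] (map inl (rev w)) word [::] [::] [::]
                               0 0 (fun=> [::]) (fun=> [::])))).
    apply: eval_transfer => // -[[|||||||i|i]|]; rewrite !ffunE //=.
    by rewrite catrevE cats0 map_rev.
  apply: eval_transfer => // -[[|||||||i|i]|]; rewrite !ffunE //=;
  by rewrite catrevE cats0 -map_rev revK.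
apply: (EvalSeq (s1 := (_, store_of word word g0))).
  apply: (EvalSeq (s1 := (_, sim_store w (map digit_sym (rev word)) [::] [::] [::] [::]
                               0 0 (fun=> [::]) (fun=> w)))).
    apply: eval_transfer => // -[[|||||||i|i]|]; rewrite !ffunE //=.
    by rewrite catrevE cats0 map_rev.
  apply: eval_transfer => // -[[|||||||i|i]|]; rewrite !ffunE //= ?ffunE.
  - by rewrite catrevE cats0 -map_rev revK.
  - by rewrite catrevE cats0 -map_rev revK.
  - by rewrite /left_part take0.
  by rewrite /right_part drop0.
apply: eval_act_seq; rewrite /= stack_perf_skip.
have -> : (au_start A, true, fnd, cur, prev, [ffun=> false]) = vars_of g0 fnd cur prev.
  by congr (_, _); apply/ffunP => i; rewrite !ffunE.
apply: EvalSeq Er _.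
apply: eval_act_seq; rewrite /= stack_perf_skip.
apply: EvalSeq Ev'.
by apply: eval_erase => -[[|||||||i|i]|]; rewrite !ffunE.
Qed.

Lemma search_halts v : found v = false ->
  (exists s', eval search (v, idle_store [::] [::]) s') <->
  exists ds : seq D, guess_accepting w ds.
Proof.
move=> fv; split=> [[s']|[ds]].
  pose Inv (s : sim_vars * store) := found s.1 = false /\
      (exists word, s.2 = idle_store [::] word) \/ exists ds : seq D, guess_accepting w ds.
  move=> /(eval_whileP (I := Inv)) [].
  - move=> v1 s1 s2 [[_ [word /= ->]]|Hds] _; last by right.
    have [v2 fv2 Ev2] := eval_attempt v1 word.
    (* By determinism the given evaluation is the one just constructed. *)
    move=> /(eval_det (@stack_perf_skip _ _ _) Ev2) <-.
    case E: (guess_accepting w word); first by right; exists word.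
    by left; rewrite /= fv2; split=> //; exists (next_word d0 word).
  - by left; split=> //; exists [::].
  by move=> [[-> _]|].
(* The accepting word comes up after [n] attempts, unless an earlier success ends the search. *)
have [n <-] := next_word_surj d0 ds.
elim: n [::] v fv => [|n IH] word v fv acc.
  have [v2 fv2 Ev2] := eval_attempt v word.
  eexists; apply: EvalWhileT Ev2 _; first by rewrite fv.
  by apply: EvalWhileF; rewrite fv2 acc.
have [v2 fv2 Ev2] := eval_attempt v word.
case E: (guess_accepting w word).
  eexists; apply: EvalWhileT Ev2 _; first by rewrite fv.
  by apply: EvalWhileF; rewrite fv2 E.
have [||s' Es'] := IH (next_word d0 word) v2; [by rewrite fv2|by rewrite -iterSr|].
by exists s'; apply: EvalWhileT Ev2 Es'; rewrite fv.
Qed.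

End Simulation.

End AutomatonToTuring.

Lemma R_Z2_subset_RE (Sigma : finType) (L : language Sigma) :
  R_class Z2_model L -> RE L.
Proof.
move=> [h [A [_ HL]]].
(* With an empty memory alphabet there is no memory content, hence no accepted word, and a machine
   without accepting states will do. *)
case: (pickP (au_mem A)) => [d0 _|D0]; last first.
  exists (@TuringMachine Sigma 0 unit unit (fun q t => (q, [ffun i => (t i, MoveN)]))
            tt pred0) => w.
  split=> [/HL [mu _]|[t]] //.
  by have := D0 (mu (mm_init Z2_model)).
pose v0 : sim_vars A := (au_start A, true, false, d0, d0, [ffun=> false]).
exists (stack_tm (search d0) v0) => w.
have initE : stack_init (sim_reg h) (sim_work A) w = @idle_store _ _ A w [::] [::].
  by apply/ffunP => -[[|||||||i|i]|]; rewrite !ffunE.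
split.
  move=> /HL /guess_accepting_complete Hds; apply/stack_tm_accepts; rewrite initE.
  exact/search_halts.
move=> /stack_tm_accepts; rewrite initE => /search_halts [//|ds].
by move=> /(guess_accepting_sound d0) /HL.
Qed.

Theorem theorem8 (Sigma : finType) (L : language Sigma) :
  R_class Z2_model L <-> RE L.
Proof. split; [exact: R_Z2_subset_RE | exact: RE_subset_R_Z2]. Qed.
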